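(* For each $n$ let $d$ be a positive integer, let $\mathbf{x}=\{x_1,\ldots,x_n\}$ be points of the unit sphere $\mathbb{S}^{d-1}\subset\mathbb{R}^d$, and let $r\in[0,2]$, $p\in[0,1]$, $s\in[0,1]$ (all possibly depending on $n$). Let $(G_1,G_2)$ be a pair of correlated noisy random geometric graphs with parameters $(\mathbf{x},r,p)$, subsampling probability $s$, and latent permutation $\pi_*$. Suppose that $p=n^{-1+o(1)}$ and that for some constant $\epsilon>0$ $$ps^2\min_{i\in[n]}\bigl|\{j\in[n]:\|x_i-x_j\|_2\le r\}\bigr|\ge\max\{s\sqrt{np},154\}+\epsilon .$$ Let $k=13$ and let $(\widehat M_k,\widehat\mu_k)$ be the $k$-core estimator of $(G_1,G_2)$. Then with probability $1-o(1)$ as $n\to\infty$ it holds that $$|\widehat M_k|\ge\Bigl(1-3e^{-\min_{i\in[n]}\sum_{j=1}^n p_{ij}s^2/7}\Bigr)n-o(n)\quad\text{and}\quad\widehat\mu_k\{\widehat M_k\}=\pi_*\{\widehat M_k\},$$ where $p_{ij}=p\,\mathbf{1}(\|x_i-x_j\|_2\le r)$ for distinct $i,j$, and $p_{ii}=0$.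
   Context: Correlated noisy random geometric graphs with parameters $(\mathbf{x},r,p)$ and subsampling probability $s$: generate a simple undirected random graph $G$ on $[n]$ in which each edge $\{i,j\}$, $i\ne j$, is present with probability $p_{ij}=p\,\mathbf{1}(\|x_i-x_j\|_2\le r)$, independently over unordered pairs; conditionally on $G$, generate $G_1$ and $G_2'$ independently, each keeping every edge of $G$ independently with probability $s$ (same vertex set $[n]$); finally let $\pi_*$ be an independent uniformly random permutation of $[n]$ and let $G_2$ be $G_2'$ with vertices relabelled by $\pi_*$, so that $\{\pi_*(i),\pi_*(j)\}$ is an edge of $G_2$ iff $\{i,j\}$ is an edge of $G_2'$. A matching is a pair $(M,\mu)$ with $M\subseteq[n]$ and $\mu:M\to[n]$ injective. $G_1\wedge_\mu G_2$ is the graph on vertex set $M$ in which $\{i,j\}$ is an edge iff $\{i,j\}$ is an edge of $G_1$ and $\{\mu(i),\mu(j)\}$ is an edge of $G_2$. A matching is a $k$-core matching if every vertex of $G_1\wedge_\mu G_2$ has degree at least $k$ (the empty matching qualifies vacuously). The $k$-core estimator $(\widehat M_k,\widehat\mu_k)$ is a $k$-core matching of $(G_1,G_2)$ with $|M|$ as large as possible among all $k$-core matchings (ties broken arbitrarily). For a map $\mu$ and a subset $S$ of its domain, $\mu\{S\}:=\{(i,\mu(i)):i\in S\}$. $p=n^{-1+o(1)}$ means $p=n^{-1+\varepsilon_n}$ for some deterministic sequence $\varepsilon_n\to0$; the $o(n)$ term denotes a deterministic sequence $a_n$ with $a_n/n\to0$. *)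

(* Defs.v *)
From HB Require Import structures.
From mathcomp Require Import all_boot all_order all_algebra all_fingroup.
From mathcomp Require Import all_classical all_reals all_analysis.

Set Implicit Arguments.
Unset Strict Implicit.
Unset Printing Implicit Defensive.

Import Order.TTheory GRing.Theory Num.Theory.
Import numFieldNormedType.Exports.

Local Open Scope ring_scope.

(* The random objects are finite, so their laws are given by probability mass
   functions.  All sets below are finite sets, not classical sets. *)

(* The norm [`|v|] of the library on row vectors is the sup norm. *)
Definition l2norm (R : realType) (d : nat) (v : 'rV[R]_d) : R :=
  Num.sqrt (\sum_(j < d) v 0 j ^+ 2).

(* The minimum of [f] over a nonempty index set (0 by convention if [n = 0]). *)
Definition min_over (R : realType) (n : nat) : ('I_n -> R) -> R :=
  match n with
  | 0 => fun _ => 0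
  | m.+1 => fun f => \big[Num.min/f ord0]_(i < m.+1) f i
  end.

(* A graph on the vertex set {0, ..., n-1} is its set of edges; the edges of a
   simple undirected graph are two-element sets of vertices. *)
Definition graph (n : nat) := {set {set 'I_n}}.

Definition complete_graph (n : nat) : graph n :=
  [set e : {set 'I_n} | #|e| == 2]%SET.

Definition simple_graph (n : nat) (G : graph n) : bool :=
  G \subset complete_graph n.

Definition adj (n : nat) (G : graph n) (i j : 'I_n) : bool :=
  [set i; j]%SET \in G.

Definition degree (n : nat) (G : graph n) (i : 'I_n) : nat :=
  #|[set j : 'I_n | adj G i j]%SET|.

Definition relabel (n : nat) (pi : 'S_n) (G : graph n) : graph n :=
  [set pi @: e | e : {set 'I_n} in G]%SET.

(* Mass at [H] of the random subgraph of [G] keeping each edge {i, j} of [G]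
   independently with probability [q i j]; an unordered pair {i, j} is
   represented once in the product, by [i < j]. *)
Definition subgraph_pmf (R : realType) (n : nat) (G : graph n)
    (q : 'I_n -> 'I_n -> R) (H : graph n) : R :=
  if H \subset G then
    \prod_(i < n) \prod_(j < n | (i < j)%N && adj G i j)
      (if adj H i j then q i j else 1 - q i j)
  else 0.

Section CorrelatedGeometricGraphs.
Variables (R : realType) (n d : nat).
Variables (x : 'I_n -> 'rV[R]_d) (r p s : R).

Definition edge_prob (i j : 'I_n) : R :=
  if (i != j) && (l2norm (x i - x j) <= r) then p else 0.

(* An outcome is (G, G_1, G_2', pi_* ). *)
Definition outcome := (graph n * graph n * graph n * 'S_n)%type.

Definition corr_pmf (w : outcome) : R :=
  let: (G, G1, G2', pi) := w in
  subgraph_pmf (complete_graph n) edge_prob G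
  * subgraph_pmf G (fun _ _ => s) G1
  * subgraph_pmf G (fun _ _ => s) G2'
  * (n`!%:R)^-1.

(* Probability of an event on (G_1, G_2, pi_* ). *)
Definition corr_prob (E : graph n -> graph n -> 'S_n -> bool) : R :=
  \sum_(w : outcome |
          let: (_, G1, G2', pi) := w in E G1 (relabel pi G2') pi) corr_pmf w.

(* Number of j, including j = i, at distance at most r from i. *)
Definition ball_count (i : 'I_n) : nat :=
  #|[set j : 'I_n | l2norm (x i - x j) <= r]%SET|.

End CorrelatedGeometricGraphs.

(* A pair (M, mu) with mu injective on M.  The values of mu outside M are
   irrelevant: nothing below depends on them. *)
Definition pre_matching (n : nat) := ({set 'I_n} * {ffun 'I_n -> 'I_n})%type.

Definition is_matching (n : nat) (m : pre_matching n) : Prop :=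
  {in m.1 &, injective m.2}.

(* The graph G_1 /\_mu G_2 on the vertex set M. *)
Definition intersection_graph (n : nat) (G1 G2 : graph n) (m : pre_matching n) :
    graph n :=
  [set e : {set 'I_n} |
    [&& e \subset m.1, e \in G1 & m.2 @: e \in G2]]%SET.

Definition is_kcore_matching (n k : nat) (G1 G2 : graph n)
    (m : pre_matching n) : Prop :=
  is_matching m /\
  forall i, i \in m.1 -> (k <= degree (intersection_graph G1 G2 m) i)%N.

Definition is_max_kcore_matching (n k : nat) (G1 G2 : graph n)
    (m : pre_matching n) : Prop :=
  is_kcore_matching k G1 G2 m /\
  forall m', is_kcore_matching k G1 G2 m' -> (#|m'.1| <= #|m.1|)%N.

(* A rule choosing one maximum k-core matching for each pair of graphs, i.e.
   the k-core estimator with some tie-breaking. *)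
Definition is_kcore_estimator (n k : nat)
    (est : graph n -> graph n -> pre_matching n) : Prop :=
  forall G1 G2, simple_graph G1 -> simple_graph G2 ->
    is_max_kcore_matching k G1 G2 (est G1 G2).

(* mu{S} = {(i, mu i) : i in S}. *)
Definition restr_graph (n : nat) (mu : 'I_n -> 'I_n) (S : {set 'I_n}) :
    {set 'I_n * 'I_n} :=
  [set (i, mu i) | i in S]%SET.

(* Main.v *)
Require Import Defs.
From HB Require Import structures.
From mathcomp Require Import all_boot all_order all_algebra all_fingroup.
From mathcomp Require Import all_classical all_reals all_analysis.
From mathcomp Require Import ring lra zify.
Set Implicit Arguments.
Unset Strict Implicit.
Unset Printing Implicit Defensive.
Import Order.TTheory GRing.Theory Num.Theory.
Import numFieldNormedType.Exports.
From mathcomp Require Import fintype finset.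
Local Open Scope ring_scope.

(** Two events of the randomness, neither involving the latent permutation,
    make the conclusion hold.

    No errors ([matching_correct]). Up to relabelling by [pi_*], a matching that
    errs on a set of [e] vertices is a map [nu] moving these [e] vertices and
    fixing the others. If it is a [13]-core matching, the degrees of the [e]
    vertices sum to at least [13 e], where an edge is a pair [{i, j}] such that
    [{i, j}] and [{nu i, nu j}] are both edges of the parent graph [G], since
    [G_1] and [G_2'] are subgraphs of [G]. Extending the matching by all
    vertices that can still be matched correctly only increases this sum and
    makes it a function of [nu] alone, so that there are at most
    [C(n, e) n ^ e] cases for each [e]. The pairs swapped by [nu] contribute at
    most [e] to the sum. The others require two distinct edges of probability at
    most [p] each; two such requirements share an edge only when one
    pair is the image of the other, and splitting the pairs into three colour
    classes ([three_coloring]) makes them independent in each class. A class of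
    weight at least [4 e] has probability about
    [(p ^ 4 e ^ 2) ^ e = (n ^ (- 4 + o(1)) e ^ 2) ^ e] by Chernoff's bound
    ([bern_tail_shifted_pairs]), which is small enough for a union bound over
    [nu] ([misleading_prob]).

    A large core ([core_prob]). The permutation [pi_*] restricted to a set of
    minimum degree [13] in the common graph of [G_1] and [G_2'] is a [13]-core
    matching, so the estimator is at least as large as any such set. Edges of
    the common graph are independent, with probabilities [p_ij s ^ 2]. Let
    [7 Delta] be the smallest expected degree. A vertex has degree below [21]
    with probability at most [exp (- Delta)], and the number of such vertices
    concentrates, its variance being [n ^ (1 + o(1))] by the Efron--Stein
    inequality ([bern_variance]). Absorbing greedily the vertices with few
    neighbours outside at most triples this set up to [o(n)], for otherwise some
    set of [m ~ 3 exp (- Delta) n + o(n)] vertices would contain [6 m] edges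
    ([core_of_sparse]); a union bound rules this out ([sparse_prob]) as soon as
    [lam (lam m / n) ^ 5] is small, where [lam = n p s ^ 2]. The hypothesis
    yields [7 Delta >= max (sqrt lam, 154)], so that [exp (- Delta)] beats the
    powers of [lam] ([core_numerics]). *)

(** * Random subsets with independent elements *)

Lemma set_insert_ind (T : finType) (P : {set T} -> Prop) :
  P set0 ->
  (forall e (G : {set T}), e \notin G -> P G -> P (e |: G)%SET) ->
  forall G, P G.
Proof.
move=> P0 PS G; have [k] := ubnP #|G|; elim: k G => // k IHk G ltGk.
have [->//|[e eG]] := set_0Vmem G.
rewrite -(setD1K eG); apply: PS; first by rewrite !inE eqxx.
by apply: IHk; rewrite [#|G|](cardsD1 e) eG in ltGk.
Qed.

Lemma subsetU1_notin (T : finType) (e : T) (G H : {set T}) :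
  e \notin H -> (H \subset e |: G) = (H \subset G).
Proof.
move=> eH; apply/idP/idP => [/subsetP HG|HG]; last exact: subset_trans HG (subsetUr _ _).
apply/subsetP => f fH; move: (HG f fH); rewrite !inE => /orP[/eqP fe|//].
by rewrite -fe fH in eH.
Qed.

Section RandomSubset.
Variables (R : realType) (T : finType).
Implicit Types (q t : T -> R) (G H A C : {set T}) (F : {set T} -> R) (e : T).

Definition bern_pmf q G H : R :=
  if H \subset G then \prod_(e in G) (if e \in H then q e else 1 - q e) else 0.

(** The expectation of [F] over the random subset of [G] that keeps each
    element [e] independently with probability [q e]. *)
Definition bern_exp q G F : R := \sum_(H : {set T}) bern_pmf q G H * F H.

Lemma bern_exp_supp q G F F' :
  (forall H, H \subset G -> F H = F' H) -> bern_exp q G F = bern_exp q G F'.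
Proof.
move=> eqF; apply: eq_bigr => H _; rewrite /bern_pmf.
by case: ifP => [/eqF->//|_]; rewrite !mul0r.
Qed.

Lemma bern_exp0 q F : bern_exp q set0 F = F set0.
Proof.
rewrite /bern_exp (bigD1 set0) //= big1 ?addr0.
  by rewrite /bern_pmf sub0set big_set0 mul1r.
by move=> H H0; rewrite /bern_pmf subset0 (negPf H0) mul0r.
Qed.

(** Revealing one element first. This recursion allows proofs by induction on
    the ground set. *)
Lemma bern_exp_insert q G F e : e \notin G ->
  bern_exp q (e |: G)%SET F =
  q e * bern_exp q G (fun H => F (e |: H)%SET) + (1 - q e) * bern_exp q G F.
Proof.
move=> eG; rewrite /bern_exp (bigID (fun H : {set T} => e \in H)) /=.
(* The sets containing [e] are the [e |: H] with [e \notin H]; toggling [e] is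
   used for reindexing because it is an involution on all sets. *)
rewrite !big_distrr /=; congr (_ + _).
  have onto : {on [pred H : {set T} | e \in H], bijective
      (fun H : {set T} => if e \in H then (H :\ e)%SET else (e |: H)%SET)}.
    exists (fun H : {set T} => if e \in H then (H :\ e)%SET else (e |: H)%SET).
      move=> H _; have [eH|eH] := boolP (e \in H); first by rewrite !inE eqxx setD1K.
      by rewrite !inE eqxx setU1K.
    move=> H; rewrite inE => eH; rewrite eH !inE eqxx setD1K //.
  rewrite (reindex _ onto) /= [RHS](bigID (fun H : {set T} => e \in H)) /=.
  rewrite [X in _ = X + _]big1 ?add0r => [|H eH]; last first.
    rewrite /bern_pmf; case: ifP => [/subsetP/(_ e eH)|]; last by rewrite mul0r mulr0.
    by rewrite (negPf eG).
  apply: eq_big => [H|H].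
    by case: ifP => eH; rewrite !inE eqxx.
  have [eH|eH _] := boolP (e \in H); first by rewrite !inE eqxx.
  rewrite /bern_pmf subUset sub1set !inE eqxx /=.
  rewrite subsetU1_notin //; case: ifP => HG; last by rewrite !mul0r mulr0.
  rewrite big_setU1 //= !inE eqxx /= -!mulrA; congr (_ * (_ * _)).
  by apply: eq_bigr => f fG; rewrite !inE; case: eqP => // fe; rewrite -fe fG in eG.
rewrite [RHS](bigID (fun H : {set T} => e \in H)) /=.
rewrite [X in _ = X + _]big1 ?add0r => [|H eH]; last first.
  rewrite /bern_pmf; case: ifP => [/subsetP/(_ e eH)|]; last by rewrite mul0r mulr0.
  by rewrite (negPf eG).
apply: eq_bigr => H eH; rewrite /bern_pmf.
rewrite subsetU1_notin //; case: ifP => HG; last by rewrite !mul0r mulr0.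
by rewrite big_setU1 //= (negPf eH) -!mulrA.
Qed.

Lemma bern_expD q G F F' :
  bern_exp q G (fun H => F H + F' H) = bern_exp q G F + bern_exp q G F'.
Proof. by rewrite -big_split; apply: eq_bigr => H _ /=; rewrite mulrDr. Qed.

Lemma bern_expZ q G c F :
  bern_exp q G (fun H => c * F H) = c * bern_exp q G F.
Proof. by rewrite /bern_exp big_distrr; apply: eq_bigr => H _ /=; rewrite mulrCA. Qed.

Lemma bern_exp_sum q G (I : Type) (r : seq I) (P : pred I) (F : I -> {set T} -> R) :
  bern_exp q G (fun H => \sum_(i <- r | P i) F i H) =
  \sum_(i <- r | P i) bern_exp q G (F i).
Proof.
by rewrite /bern_exp exchange_big; apply: eq_bigr => H _ /=; rewrite big_distrr.
Qed.

(** Generating function: distinct elements are kept independently. *)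
Lemma bern_exp_prod q G t :
  bern_exp q G (fun H => \prod_(e in H) t e) =
  \prod_(e in G) (1 - q e + q e * t e).
Proof.
elim/set_insert_ind: G => [|e G eG IH]; first by rewrite bern_exp0 !big_set0.
rewrite bern_exp_insert // big_setU1 //= -IH [RHS]mulrDl [RHS]addrC; congr (_ + _).
rewrite -mulrA; congr (_ * _); rewrite -bern_expZ; apply: bern_exp_supp => H HG.
by rewrite big_setU1 //; apply: contra eG; apply/subsetP.
Qed.

Lemma bern_exp_const q G c : bern_exp q G (fun=> c) = c.
Proof.
elim/set_insert_ind: G => [|e G eG IH]; first by rewrite bern_exp0.
by rewrite bern_exp_insert // IH; ring.
Qed.

Section UnitWeights.
Variables (q : T -> R).
Hypothesis q01 : forall e, 0 <= q e <= 1.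

Lemma bern_pmf_ge0 G H : 0 <= bern_pmf q G H.
Proof.
rewrite /bern_pmf; case: ifP => // _; apply: prodr_ge0 => e _.
by have /andP[q0 q1] := q01 e; case: ifP => // _; rewrite subr_ge0.
Qed.

Lemma ler_bern_exp G F F' :
  (forall H, H \subset G -> F H <= F' H) -> bern_exp q G F <= bern_exp q G F'.
Proof.
move=> leF; apply: ler_sum => H _.
have [/leF FH|HG] := boolP (H \subset G); first by apply: ler_wpM2l => //; exact: bern_pmf_ge0.
by rewrite /bern_pmf (negPf HG) !mul0r.
Qed.

Lemma bern_exp_ge0 G F : (forall H, H \subset G -> 0 <= F H) -> 0 <= bern_exp q G F.
Proof. by move=> F0; rewrite -(bern_exp_const q G 0); apply: ler_bern_exp. Qed.

Lemma bern_exp_superset (p : R) G C : (forall e, q e <= p) ->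
  bern_exp q G (fun H => (C \subset H)%:R) <= p ^+ #|C|.
Proof.
move=> qp; elim/set_insert_ind: G C => [|e G eG IH] C.
  rewrite bern_exp0 subset0; have [->|C0] := eqVneq C set0; first by rewrite cards0.
  have [x _] := set0Pn _ C0; rewrite exprn_ge0 //.
  by have /andP[q0 _] := q01 x; exact: le_trans q0 (qp x).
have /andP[q0 q1] := q01 e.
rewrite bern_exp_insert //; have [eC|eC] := boolP (e \in C).
  rewrite [X in _ + _ * X](@bern_exp_supp _ _ _ (fun=> 0)) => [|H HG]; last first.
    case: subsetP => // /(_ e eC) /(subsetP HG) eG'.
    by rewrite eG' in eG.
  rewrite bern_exp_const mulr0 addr0 (cardsD1 e) eC exprS.
  apply: ler_pM => //; first exact: bern_exp_ge0.
  apply: le_trans (IH _); apply: ler_bern_exp => H HG.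
  rewrite ler_nat; case: (boolP (C \subset e |: H)%SET) => // CH.
  by rewrite subDset CH.
have le1 : bern_exp q G (fun H => (C \subset e |: H)%:R)%SET <= p ^+ #|C|.
  apply: le_trans (IH C); apply: ler_bern_exp => H HG.
  by rewrite subsetU1_notin.
apply: (@le_trans _ _ (q e * p ^+ #|C| + (1 - q e) * p ^+ #|C|)); last first.
  by rewrite -mulrDl addrC subrK mul1r.
by apply: lerD; apply: ler_wpM2l => //; rewrite subr_ge0.
Qed.

(** Efron--Stein inequality. Conditioning on one element splits the variance
    into the average variance of the rest and the variance of a two-valued
    variable whose values differ by at most [c]. *)
Lemma bern_variance (c : R) G F :
  0 <= c -> (forall e H, e \in G -> `|F (e |: H)%SET - F H| <= c) ->
  bern_exp q G (fun H => F H ^+ 2) - bern_exp q G F ^+ 2 <=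
  c ^+ 2 * \sum_(e in G) q e.
Proof.
move=> c0; elim/set_insert_ind: G F => [|e G eG IH] F Fc.
  by rewrite !bern_exp0 big_set0 mulr0 subrr.
have /andP[q0 q1] := q01 e.
rewrite !bern_exp_insert // big_setU1 //=.
set F1 := fun H => F (e |: H)%SET.
have {}Fc f H : (f == e) || (f \in G) -> `|F (f |: H)%SET - F H| <= c.
  by move=> fG; apply: Fc; rewrite !inE.
have IH0 : bern_exp q G (fun H => F H ^+ 2) - bern_exp q G F ^+ 2 <=
  c ^+ 2 * \sum_(e in G) q e.
  by apply: IH => f H fG; rewrite Fc ?fG ?orbT.
have IH1 : bern_exp q G (fun H => F1 H ^+ 2) - bern_exp q G F1 ^+ 2 <=
  c ^+ 2 * \sum_(e in G) q e.
  by apply: IH => f H fG; rewrite /F1 setUCA Fc ?fG ?orbT.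
have dist : (bern_exp q G F1 - bern_exp q G F) ^+ 2 <= c ^+ 2.
  rewrite -real_normK ?num_real // ler_sqr ?nnegrE //.
  have -> : bern_exp q G F1 - bern_exp q G F = bern_exp q G (fun H => F1 H - F H).
    by rewrite [RHS]bern_expD -[X in _ + X = _]mulN1r -bern_expZ; congr (_ + _);
       apply: bern_exp_supp => H _; rewrite mulN1r.
  apply: le_trans (ler_norm_sum _ _ _) _.
  rewrite -[leRHS](bern_exp_const q G c); apply: ler_sum => H _.
  by rewrite normrM ger0_norm ?bern_pmf_ge0 // ler_wpM2l ?bern_pmf_ge0 // Fc ?eqxx.
set a := bern_exp q G F1 in dist IH1 *; set b := bern_exp q G F in dist IH0 *.
move: IH0 IH1; set a2 := bern_exp q G (fun H => F1 H ^+ 2).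
set b2 := bern_exp q G _; set S := \sum_(e in G) q e => IH0 IH1.
have -> : q e * a2 + (1 - q e) * b2 - (q e * a + (1 - q e) * b) ^+ 2 =
   q e * (a2 - a ^+ 2) + (1 - q e) * (b2 - b ^+ 2) + q e * (1 - q e) * (a - b) ^+ 2.
  by ring.
have -> : c ^+ 2 * (q e + S) = q e * (c ^+ 2 * S) + (1 - q e) * (c ^+ 2 * S) + q e * c ^+ 2.
  by ring.
have q1' : 0 <= 1 - q e by rewrite subr_ge0.
apply: lerD; first by apply: lerD; apply: ler_wpM2l.
rewrite -mulrA ler_wpM2l //; apply: le_trans dist.
by rewrite -[leRHS]mul1r ler_wpM2r ?sqr_ge0 // lerBlDr lerDl.
Qed.

Lemma bern_chebyshev (c tau : R) G F :
  0 <= c -> (forall e H, e \in G -> `|F (e |: H)%SET - F H| <= c) -> 0 < tau ->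
  bern_exp q G (fun H => (bern_exp q G F + tau <= F H)%R%:R) <=
  c ^+ 2 * (\sum_(e in G) q e) / tau ^+ 2.
Proof.
move=> c0 Fc tau0; set mu := bern_exp q G F.
apply: (@le_trans _ _ (bern_exp q G (fun H => (tau ^+ 2)^-1 * (F H - mu) ^+ 2))).
  apply: ler_bern_exp => H _; case: (boolP (mu + tau <= F H)) => [le_tau|_]; last first.
    by rewrite mulr_ge0 ?invr_ge0 ?sqr_ge0.
  rewrite mulrC ler_pdivlMr ?exprn_gt0 // mul1r.
  by apply: lerXn2r; rewrite ?nnegrE ?(ltW tau0) //; lra.
rewrite bern_expZ mulrC ler_wpM2r ?invr_ge0 ?sqr_ge0 //.
apply: le_trans (bern_variance c0 Fc); rewrite -/mu.
rewrite (@bern_exp_supp _ _ _ (fun H => F H ^+ 2 + ((- 2 * mu) * F H + mu ^+ 2))).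
  by rewrite !bern_expD bern_expZ bern_exp_const -/mu; nra.
by move=> H _; ring.
Qed.

End UnitWeights.

(** Two successive independent selections act as one: the graphs [G] and then
    [G_1], [G_2] are built by successive selections, and this is what makes the
    common edges of [G_1] and [G_2] independent. *)
Lemma bern_exp_thin q q' G F :
  bern_exp q G (fun H => bern_exp q' H F) =
  bern_exp (fun e => q e * q' e) G F.
Proof.
elim/set_insert_ind: G F => [|e G eG IH] F; first by rewrite !bern_exp0.
rewrite !bern_exp_insert // -!IH.
rewrite (@bern_exp_supp _ _ (fun H => bern_exp q' (e |: H)%SET F)
  (fun H => q' e * bern_exp q' H (fun H => F (e |: H)%SET) +
     (1 - q' e) * bern_exp q' H F)) => [|H HG]; last first.
  by rewrite bern_exp_insert //; apply: contra eG; apply/subsetP.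
by rewrite bern_expD !bern_expZ; ring.
Qed.

Lemma bern_exp_restrict q G A F :
  bern_exp q G (fun H => F (A :&: H)%SET) = bern_exp q (A :&: G)%SET F.
Proof.
elim/set_insert_ind: G F => [|e G eG IH] F.
  by rewrite setI0 !bern_exp0 setI0.
rewrite bern_exp_insert //; have [eA|eA] := boolP (e \in A).
  have -> : (A :&: (e |: G) = e |: (A :&: G))%SET.
    by rewrite setIUr; congr (_ :|: _)%SET; apply/setIidPr; rewrite sub1set.
  rewrite bern_exp_insert ?inE ?eA // -!IH; congr (_ * _ + _).
  apply: bern_exp_supp => H _; rewrite setIUr; congr (F (_ :|: _)%SET).
  by apply/setIidPr; rewrite sub1set.
have AeH H : (A :&: (e |: H) = A :&: H)%SET.
  apply/setP => f; rewrite !inE; case: eqP => //= ->; by rewrite (negPf eA).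
rewrite AeH -IH (@bern_exp_supp _ _ _ (fun H => F (A :&: H)%SET)); first by ring.
by move=> H _; rewrite AeH.
Qed.

End RandomSubset.

(** * Tail bounds for pairs [e, f e] in a random set *)

Lemma ord3_avoid2 (a b : 'I_3) : exists k : 'I_3, (k != a) && (k != b).
Proof.
have [k|none] := pickP (fun k : 'I_3 => (k != a) && (k != b)); first by exists k.
have sub : [set: 'I_3] \subset [set a; b].
  by apply/subsetP => k _; move: (none k); rewrite !inE; case: eqP => //= _; case: eqP.
by move: (subset_leq_card sub); rewrite cardsT card_ord cards2; case: (a != b).
Qed.

(** The graph with edges [{e, f e}] has maximum degree two, as [f] is injective;
    colour its vertices one at a time. *)
Lemma three_coloring (T : finType) (f : T -> T) (Q : {set T}) :
  {in Q &, injective f} ->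
  exists c : T -> 'I_3,
    forall e, e \in Q -> f e \in Q -> f e != e -> c (f e) != c e.
Proof.
elim/set_insert_ind: Q => [|x Q xQ IH] injf.
  by exists (fun=> ord0) => e; rewrite inE.
have [|c cP] := IH; first by move=> a b aQ bQ; apply: injf; rewrite !inE (aQ, bQ) orbT.
(* [g] is the only possible preimage of [x] in [Q]. *)
pose g := odflt x [pick y in Q | f y == x].
have [k /andP[kf kg]] := ord3_avoid2 (c (f x)) (c g).
exists (fun e => if e == x then k else c e) => e; rewrite !inE.
have [->|ex] /= := eqVneq e x.
  by move=> _ fxQ fxx; rewrite (negPf fxx) eq_sym.
move=> eQ; have [fex|fex] /= := eqVneq (f e) x; last exact: cP.
move=> _ _; suff -> : e = g by [].
rewrite /g; case: pickP => [y /andP[yQ /eqP fy]|/(_ e)] /=; last by rewrite eQ fex eqxx.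
by apply: injf; rewrite ?inE ?eQ ?yQ ?orbT // fex fy.
Qed.

Lemma prod_1plus (R : comNzRingType) (T : finType) (C : {set T}) (a : T -> R) :
  \prod_(e in C) (1 + a e) = \sum_(J : {set T} | J \subset C) \prod_(e in J) a e.
Proof.
transitivity (\prod_e ((if e \in C then a e else 0) + 1)).
  rewrite [RHS](bigID (mem C)) /= [X in _ = _ * X]big1 => [|e /negPf->]; last by rewrite add0r.
  by rewrite mulr1; apply: eq_bigr => e ->; rewrite addrC.
rewrite bigA_distr (bigID (fun J : {set T} => J \subset C)) /= [X in _ + X]big1 ?addr0.
  apply: eq_bigr => J /subsetP JC; rewrite [LHS](bigID (mem J)) /=.
  rewrite [X in _ * X]big1 ?mulr1 => [|e /negPf->//].
  by apply: eq_bigr => e eJ; rewrite eJ JC.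
move=> J; case/subsetPn => e eJ eC.
by rewrite (bigD1 e) //= eJ (negPf eC) mul0r.
Qed.

Section CorrelatedPairs.
Variables (R : realType) (T : finType) (q : T -> R) (p : R).
Hypothesis q01 : forall e, 0 <= q e <= 1.
Hypothesis qp : forall e, q e <= p.
Variables (K : {set T}) (f : T -> T).

Definition both_in (H : {set T}) e := (e \in H) && (f e \in H).

(** In [C] the points [e] and [f e] are all distinct, so the events
    [both_in H e] are independent of probability at most [p ^+ 2]. Expanding
    both products reduces this to the probability that a given set is kept. *)
Lemma bern_exp_pairs (C : {set T}) (t : T -> R) : (forall e, 0 <= t e) ->
  {in C &, injective f} -> {in C &, forall e e', f e != e'} ->
  bern_exp q K (fun H => \prod_(e in C) (1 + t e * (both_in H e)%:R)) <=
  \prod_(e in C) (1 + t e * p ^+ 2).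
Proof.
move=> t0 injf sepf.
under (@bern_exp_supp _ _ q K) => H _ do rewrite prod_1plus.
rewrite bern_exp_sum prod_1plus; apply: ler_sum => J JC.
rewrite (@bern_exp_supp _ _ _ _ _
  (fun H => \prod_(e in J) t e * ((J :|: f @: J) \subset H)%:R)); last first.
  move=> H _; rewrite big_split /=; congr (_ * _).
  rewrite subUset; have [/andP[/subsetP JH /subsetP fJH]|] := boolP (_ && _).
    by rewrite big1 // => e eJ; rewrite /both_in JH // fJH // imset_f.
  move=> nsub; suff [e eJ be] : exists2 e, e \in J & ~~ both_in H e.
    by rewrite (bigD1 e) //= (negPf be) mul0r.
  case/nandP: nsub => /subsetPn [x].
    by move=> xJ xH; exists x => //; rewrite /both_in (negPf xH).
  by case/imsetP => e eJ -> feH; exists e; rewrite // /both_in (negPf feH) andbF.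
rewrite bern_expZ big_split /= ler_wpM2l ?prodr_ge0 // prodr_const -exprM.
apply: le_trans (bern_exp_superset _ _ _ qp) _ => //.
rewrite cardsU disjoint_setI0 ?cards0 ?subn0.
  rewrite card_in_imset ?addnn ?mul2n //.
  by move=> a b aJ bJ; apply: injf; apply: (subsetP JC).
rewrite disjoint_sym; apply/pred0P => e /=; apply/negP => /andP[/imsetP[e' e'J ->]].
by move/(subsetP JC) => fe'C; have := sepf e' _ (subsetP JC _ e'J) fe'C; rewrite eqxx.
Qed.

(** Chernoff's bound for the weighted number of kept pairs. *)
Lemma bern_tail_pairs (C : {set T}) (w : T -> nat) (th : R) (k : nat) : 1 <= th ->
  {in C &, injective f} -> {in C &, forall e e', f e != e'} ->
  bern_exp q K (fun H => (k <= \sum_(e in C) w e * both_in H e)%N%:R) <=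
  th ^- k * expR (p ^+ 2 * \sum_(e in C) th ^+ w e).
Proof.
move=> th1 injf sepf; have th0 : 0 < th by apply: lt_le_trans th1.
have t0 e : 0 <= th ^+ w e - 1 by rewrite subr_ge0 exprn_ege1.
apply: (@le_trans _ _ (bern_exp q K (fun H => th ^- k *
    \prod_(e in C) (1 + (th ^+ w e - 1) * (both_in H e)%:R)))).
  apply: ler_bern_exp => // H _.
  have -> : \prod_(e in C) (1 + (th ^+ w e - 1) * (both_in H e)%:R) =
            th ^+ (\sum_(e in C) w e * both_in H e)%N.
    rewrite -prodrXr; apply: eq_bigr => e _; case: both_in; rewrite ?muln1 ?muln0.
      by rewrite mulr1 addrC subrK.
    by rewrite mulr0 addr0 expr0.
  case: leqP => [le_k|_]; last by rewrite mulr_ge0 ?invr_ge0 ?exprn_ge0 ?(ltW th0).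
  by rewrite mulrC ler_pdivlMr ?exprn_gt0 // mul1r ler_weXn2l.
rewrite bern_expZ ler_wpM2l ?invr_ge0 ?exprn_ge0 ?(ltW th0) //.
apply: le_trans (bern_exp_pairs t0 injf sepf) _.
rewrite mulr_sumr expR_sum; apply: ler_prod => e _.
have p20 : 0 <= p ^+ 2 by exact: sqr_ge0.
have p0 : 0 <= p by have /andP[q0 _] := q01 e; exact: le_trans q0 (qp e).
rewrite addr_ge0 ?mulr_ge0 //=.
apply: le_trans (expR_ge1Dx _); rewrite lerD2l mulrC ler_wpM2l //.
by rewrite gerBl.
Qed.

(** The indicators [both_in H e] and [both_in H e'] are dependent only when
    [e' = f e] or [e = f e']; a three-colouring of this relation leaves
    independent indicators in each class, and one class carries a third of the
    total weight. *)
Lemma bern_tail_shifted_pairs (Q : {set T}) (w : T -> nat) (th : R) (k : nat) :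
  1 <= th -> {in Q &, injective f} -> {in Q, forall e, f e != e} ->
  bern_exp q K (fun H => (3 * k <= \sum_(e in Q) w e * both_in H e)%N%:R) <=
  3 * (th ^- k * expR (p ^+ 2 * \sum_(e in Q) th ^+ w e)).
Proof.
move=> th1 injf nofix; have th0 : 0 < th by apply: lt_le_trans th1.
have [->|k0] := posnP k.
  rewrite muln0; under (@bern_exp_supp _ _ q K) => H _ do rewrite leq0n.
  rewrite bern_exp_const expr0 invr1 mul1r.
  have : 1 <= expR (p ^+ 2 * \sum_(e in Q) th ^+ w e).
    rewrite -[X in X <= _]expR0 ler_expR mulr_ge0 ?sqr_ge0 // sumr_ge0 // => e _.
    by rewrite exprn_ge0 // ltW.
  move=> /= X1; lra.
have [c cP] := three_coloring injf.
pose C i := [set e in Q | c e == i].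
have CQ i : C i \subset Q by apply/subsetP => e; rewrite inE => /andP[].
apply: (@le_trans _ _ (bern_exp q K (fun H =>
    \sum_(i < 3) (k <= \sum_(e in C i) w e * both_in H e)%N%:R))).
  apply: ler_bern_exp => // H _; case: leqP => [le_k|_]; last first.
    by apply: sumr_ge0.
  suff [i le_ki] : exists i : 'I_3, (k <= \sum_(e in C i) w e * both_in H e)%N.
    by rewrite (bigD1 i) //= le_ki lerDl sumr_ge0.
  apply/existsP; apply: contraLR le_k => /existsPn all_lt; rewrite -ltnNge.
  rewrite (partition_big c predT) //=.
  apply: (@leq_ltn_trans (\sum_(i < 3) k.-1)%N); last first.
    by rewrite sum_nat_const card_ord ltn_pmul2l // prednK.
  apply: leq_sum => i _; move: (all_lt i); rewrite -ltnNge.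
  rewrite -[X in (_ < X)%N -> _](prednK k0) ltnS; apply: leq_trans.
  by apply/eq_leq/eq_bigl => e; rewrite inE.
rewrite bern_exp_sum mulr_natl.
apply: (@le_trans _ _ (\sum_(i < 3) th ^- k * expR (p ^+ 2 * \sum_(e in Q) th ^+ w e))).
  apply: ler_sum => i _; apply: le_trans (bern_tail_pairs _ _ th1 _ _) _.
  - by move=> a b aC bC; apply: injf; apply: (subsetP (CQ i)).
  - move=> e e' eC e'C; apply/eqP => fe; move: eC e'C; rewrite -fe !inE.
    case/andP=> eQ /eqP ce /andP[feQ /eqP cfe].
    by have := cP e eQ feQ (nofix e eQ); rewrite ce cfe eqxx.
  rewrite ler_wpM2l ?invr_ge0 ?exprn_ge0 ?(ltW th0) // ler_expR.
  rewrite ler_wpM2l ?sqr_ge0 // [leRHS](bigID (mem (C i))) /=.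
  rewrite [X in _ <= X + _](eq_bigl (mem (C i))); last first.
    by move=> e; rewrite /= andbC; case: (boolP (e \in C i)) => //= /(subsetP (CQ i)).
  by rewrite lerDl sumr_ge0 // => e _; rewrite exprn_ge0 // ltW.
by rewrite sumr_const card_ord.
Qed.

End CorrelatedPairs.

(** * Degrees of displaced vertices *)

(** From [expR (- 2^-1) >= 2^-1]. *)
Lemma expR1_le4 (R : realType) : expR 1 <= 4 :> R.
Proof.
have half : expR (2^-1) <= 2 :> R.
  rewrite -[2^-1]opprK expRN -[leRHS]invrK lef_pV2 ?posrE ?expR_gt0 //.
  by apply: le_trans (expR_ge1Dx _); lra.
have -> : 1 = 2%:R * 2^-1 :> R by lra.
rewrite expRM_natl expr2; have := expR_ge0 (2^-1 : R); nra.
Qed.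

Lemma bin2_le (k : nat) : ('C(k, 2) <= k * k)%N.
Proof. by rewrite bin2; case: k => // k; rewrite succnK; lia. Qed.

(** [e ^ e / e`!] is one term of the exponential series at [e]. *)
Lemma fact_lower_bound (R : realType) (e : nat) : e%:R ^+ e <= 4 ^+ e * e`!%:R :> R.
Proof.
case: e => [|e]; first by rewrite !expr0 mul1r.
have f0 : 0 < e.+1`!%:R :> R by rewrite ltr0n fact_gt0.
rewrite -ler_pdivrMr //; apply: (@le_trans _ _ (expR e.+1%:R)).
  by apply: le_trans (expR_ge1Dxn e (ler0n _ e.+1)); rewrite lerDr.
rewrite -[X in expR X]mulr1 expRM_natl.
by apply: lerXn2r; rewrite ?nnegrE ?expR_ge0 ?expR1_le4.
Qed.

Lemma bin_upper_bound (R : realType) (n e : nat) : (0 < e)%N ->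
  'C(n, e)%:R <= (4 * n%:R / e%:R) ^+ e :> R.
Proof.
move=> e0; have e0R : 0 < e%:R :> R by rewrite ltr0n.
rewrite expr_div_n ler_pdivlMr ?exprn_gt0 // exprMn.
apply: le_trans (ler_wpM2l _ (fact_lower_bound R e)) _ => //.
rewrite mulrCA ler_wpM2l ?exprn_ge0 // -natrM bin_ffact -natrX ler_nat.
elim: e {e0 e0R} => // e IH; rewrite ffactnSr expnSr.
by rewrite leq_mul // leq_subr.
Qed.

Lemma ler_sum_imset (R : realType) (S T : finType) (A : {set S}) (h : S -> T) (g : T -> R) :
  (forall a, 0 <= g a) -> \sum_(a in h @: A) g a <= \sum_(x in A) g (h x).
Proof.
move=> g0; rewrite [leRHS](partition_big_imset h) /=.
apply: ler_sum => _ /imsetP[x xA ->].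
by rewrite (bigD1 x) /= ?xA ?eqxx // lerDl sumr_ge0.
Qed.

Section Displacements.
Variable n : nat.
Implicit Types (nu : {ffun 'I_n -> 'I_n}) (H : graph n).

Definition moved nu : {set 'I_n} := [set i | nu i != i].

(** The vertices that can belong to an injective partial map which agrees with
    [nu] on [moved nu] and fixes all its other points. *)
Definition free_dom nu : {set 'I_n} := moved nu :|: ~: (nu @: moved nu).

(** The sum over the moved vertices of their degrees in the intersection of [H]
    with its own image under [nu], taken on the largest possible domain. *)
Definition overlap nu H : nat :=
  \sum_(i in moved nu)
    #|[set j in free_dom nu | ([set i; j] \in H) && ([set nu i; nu j] \in H)]|.

(** A parent graph that could support a [13]-core matching with an error. *)
Definition misleading H : bool :=
  [exists nu : {ffun 'I_n -> 'I_n},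
    [&& moved nu != set0, dinjectiveb nu (mem (free_dom nu)) &
        (13 * #|moved nu| <= overlap nu H)%N]].

(** Pairs counted in [overlap], without those that [nu] swaps: for a swapped
    pair the two edges to be present are the same edge. *)
Definition shifted_pairs nu : {set {set 'I_n}} :=
  [set a in complete_graph n |
    [&& a \subset free_dom nu, a :&: moved nu != set0 & nu @: a != a]].

Lemma set2_inj (i : 'I_n) : injective (fun j => [set i; j]).
Proof.
move=> j k eq_jk; have: j \in [set i; k] by rewrite -eq_jk !inE eqxx orbT.
have: k \in [set i; j] by rewrite eq_jk !inE eqxx orbT.
by rewrite !inE => /orP[/eqP->|/eqP->//] /orP[/eqP->|/eqP->].
Qed.

(** A moved vertex [i] lies in at most one swapped pair, [{i, nu i}]; this costs
    one unit of degree per moved vertex. *)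
Lemma overlap_le nu H : H \subset complete_graph n ->
  (overlap nu H <= #|moved nu| +
     \sum_(a in shifted_pairs nu)
        #|a :&: moved nu| * both_in (fun a : {set 'I_n} => nu @: a) H a)%N.
Proof.
move=> HK; set X := both_in _ H.
have -> : (\sum_(a in shifted_pairs nu) #|a :&: moved nu| * X a =
  \sum_(i in moved nu) #|[set a in shifted_pairs nu | (i \in a) && X a]|)%N.
  under eq_bigr => a _ do rewrite -sum1_card big_distrl /=.
  under [RHS]eq_bigr => i _ do rewrite -sum1_card.
  rewrite (exchange_big_dep (mem (moved nu))) /=; last by move=> a i _ /setIP[].
  apply: eq_bigr => i iE; rewrite big_mkcond [RHS]big_mkcond; apply: eq_bigr => a _.
  by rewrite in_setI iE andbT mul1n [in RHS]in_set; case: (a \in _) => //=; case: (i \in a) => //=; case: (X a).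
rewrite -sum1_card -big_split; apply: leq_sum => i; rewrite inE => nui /=.
set J := [set j in _ | _].
have sub : J \subset nu i |: [set j in J | j != nu i].
  by apply/subsetP => j jJ; rewrite in_setU1 in_set jJ andTb; case: eqVneq.
apply: leq_trans (subset_leq_card sub) _.
rewrite cardsU1 leq_add //; first by case: (_ \in _).
rewrite -(card_imset _ (@set2_inj i)); apply/subset_leq_card/subsetP => a.
case/imsetP => j; rewrite in_set /J in_set => /andP[/and3P[jM ijH nuH] jnu] ->.
rewrite !in_set in_set1 eqxx /= /X /both_in ijH imsetU1 imset_set1 nuH !andbT.
apply/and4P; split.
- by have := subsetP HK _ ijH; rewrite in_set.
- apply/subsetP => k; rewrite in_set2 => /orP[]/eqP-> //.
  by rewrite !inE nui.
- by apply/set0Pn; exists i; rewrite !inE eqxx nui.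
- apply/eqP => eq_a; have : nu i \in [set i; j] by rewrite -eq_a !inE eqxx.
  by rewrite !inE (negPf nui) eq_sym (negPf jnu).
Qed.

(** A pair with two moved vertices has weight two, but there are at most
    [#|moved nu| ^ 2] of them; the other pairs have weight one. *)
Lemma sum_shifted_pairs (R : realType) nu (th : R) : 1 <= th ->
  \sum_(a in shifted_pairs nu) th ^+ #|a :&: moved nu| <=
  #|moved nu|%:R * (#|moved nu|%:R * th ^+ 2 + n%:R * th).
Proof.
move=> th1; have th0 : 0 <= th by apply: le_trans th1.
have g0 (a : {set 'I_n}) : 0 <= th ^+ #|a :&: moved nu| by rewrite exprn_ge0.
pose S := setX (moved nu) [set: 'I_n].
have sub : shifted_pairs nu \subset (fun x : 'I_n * 'I_n => [set x.1; x.2]) @: S.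
  apply/subsetP => a; rewrite in_set in_set => /and4P[/cards2P[x [y [xy ->]]] _ /set0Pn[i] + _].
  rewrite in_setI in_set2 => /andP[/orP[]/eqP-> ie].
    by apply/imsetP; exists (x, y); rewrite ?in_setX ?in_setT ?ie.
  by apply/imsetP; exists (y, x); rewrite ?in_setX ?in_setT ?ie //= setUC.
apply: (@le_trans _ _ (\sum_(x in S) th ^+ #|[set x.1; x.2] :&: moved nu|)).
  apply: le_trans (ler_sum_imset _ _ g0).
  rewrite [leRHS](bigID (mem (shifted_pairs nu))) /=.
  rewrite [X in _ <= X + _](eq_bigl (mem (shifted_pairs nu))); last first.
    by move=> a; rewrite /= andbC; case: (boolP (a \in shifted_pairs nu)) => //= /(subsetP sub).
  by rewrite lerDl sumr_ge0.
rewrite /S (eq_bigl (fun x : 'I_n * 'I_n => (x.1 \in moved nu) && true)); last first.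
  by case=> i j; rewrite inE in_setT.
rewrite -(pair_big (mem (moved nu)) predT
    (fun i j => th ^+ #|[set i; j] :&: moved nu|)) /= mulr_natl -sumr_const.
apply: ler_sum => i iE.
apply: (@le_trans _ _ (\sum_j ((j \in moved nu)%:R * th ^+ 2 + th))).
  apply: ler_sum => j _; have [jE|jE] := boolP (j \in moved nu).
    rewrite mul1r; apply: (@le_trans _ _ (th ^+ 2)); last by rewrite lerDl.
    rewrite ler_weXn2l //; apply: leq_trans (subset_leq_card (subsetIl _ _)) _.
    by rewrite cards2; case: eqP.
  rewrite mul0r add0r -[leRHS]expr1 ler_weXn2l //.
  rewrite -(cards1 i); apply/subset_leq_card/subsetP => k; rewrite !inE.
  by case/andP=> /orP[]// /eqP->; move: jE; rewrite inE => /negPf->.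
rewrite big_split /= sumr_const card_ord -mulr_suml -[th *+ n]mulr_natl lerD2r.
rewrite -natr_sum (_ : \sum_j (j \in moved nu) = #|moved nu|)%N //.
by rewrite -sum1_card [RHS]big_mkcond; apply: eq_bigr => j _; case: ifP.
Qed.

Lemma card_moved (e : nat) :
  (#|[set nu | #|moved nu| == e]| <= 'C(n, e) * n ^ e)%N.
Proof.
pose S := [set A : {set 'I_n} | #|A| == e].
have -> : [set nu | #|moved nu| == e] =
    \bigcup_(A in S) [set nu : {ffun 'I_n -> 'I_n} | moved nu == A].
  apply/setP => nu; rewrite inE; apply/idP/bigcupP => [mnu|[A]].
    by exists (moved nu); rewrite !inE.
  by rewrite !inE => /eqP cA /eqP ->; rewrite cA.
apply: (@leq_trans (\sum_(A in S) n ^ e)%N); last first.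
  by rewrite sum_nat_const card_draws card_ord.
apply: leq_trans (_ : \sum_(A in S) #|[set nu : {ffun 'I_n -> 'I_n} | moved nu == A]| <= _)%N.
  elim/big_rec2: _ => [|A k U _ le_k]; first by rewrite cards0.
  by apply: leq_trans (leq_card_setU _ _) _; rewrite leq_add2l.
apply: leq_sum => A; rewrite inE => /eqP <-.
pose Fam i : pred 'I_n := if i \in A then predT else pred1 i.
apply: (@leq_trans #|(family Fam : simpl_pred {ffun 'I_n -> 'I_n})|).
  apply/subset_leq_card/subsetP => nu; rewrite inE => /eqP mA; apply/familyP => i.
  by rewrite /Fam -mA in_set; case: eqP => /= [nui|_]; rewrite inE ?nui ?eqxx.
rewrite card_family foldrE big_map big_enum (bigID (mem A)) /=.
rewrite [X in (_ * X)%N]big1 ?muln1 => [|i /negPf iA]; last by rewrite /Fam iA card1.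
rewrite (eq_bigr (fun=> n)) ?prod_nat_const // => i iA.
by rewrite /Fam iA card_ord.
Qed.

End Displacements.

(** * Core matchings make no error *)

Lemma imset_inj_on (T : finType) (h : T -> T) (D : {set T}) :
  {in D &, injective h} ->
  {in [pred a : {set T} | a \subset D] &, injective (fun a : {set T} => h @: a)}.
Proof.
move=> injh a b /= aD bD eq_ab.
have sub (c d : {set T}) : c \subset D -> d \subset D -> h @: c = h @: d -> c \subset d.
  move=> /subsetP cD /subsetP dD eq_cd; apply/subsetP => x xc.
  have /imsetP[y yd hxy] : h x \in h @: d by rewrite -eq_cd imset_f.
  by rewrite (injh x y (cD x xc) (dD y yd) hxy).
by apply/eqP; rewrite eqEsubset; apply/andP; split; apply: sub.
Qed.

Lemma geometric_sum_le (R : realFieldType) (x : R) (n : nat) : 0 <= x <= 2^-1 ->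
  \sum_(i < n) x ^+ i.+1 <= 2 * x.
Proof.
move=> /andP[x0 x1].
suff : \sum_(i < n) x ^+ i.+1 <= 2 * x - 2 * x ^+ n.+1.
  by move/le_trans; apply; rewrite gerBl mulr_ge0 // exprn_ge0.
elim: n => [|n IH]; first by rewrite big_ord0 expr1 subrr.
rewrite big_ord_recr /=; have := exprn_ge0 n.+1 x0; rewrite [x ^+ n.+2]exprSr.
by move: IH; set y := x ^+ n.+1 => IH y0; nra.
Qed.

Section MisleadingProbability.
Variables (R : realType) (n : nat) (q : {set 'I_n} -> R) (p : R).
Hypothesis q01 : forall e, 0 <= q e <= 1.
Hypothesis qp : forall e, q e <= p.

(** Of the [13] units of degree per moved vertex, [12 = 3 * 4] survive the loss
    in [overlap_le], and a colour class keeps [4]. *)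
Lemma overlap_tail (nu : {ffun 'I_n -> 'I_n}) (th : R) :
  1 <= th -> {in free_dom nu &, injective nu} ->
  bern_exp q (complete_graph n)
    (fun H => (13 * #|moved nu| <= overlap nu H)%N%:R) <=
  3 * (th ^- (4 * #|moved nu|) *
       expR (p ^+ 2 * (#|moved nu|%:R * (#|moved nu|%:R * th ^+ 2 + n%:R * th)))).
Proof.
move=> th1 injnu; have th0 : 0 < th by apply: lt_le_trans th1.
set f := fun a : {set 'I_n} => nu @: a.
have sub a : a \in shifted_pairs nu -> a \subset free_dom nu.
  by rewrite in_set => /and3P[].
have injf : {in shifted_pairs nu &, injective f}.
  by move=> a b /sub aD /sub bD; apply: (imset_inj_on injnu).
have nofix : {in shifted_pairs nu, forall a, f a != a}.
  by move=> a; rewrite in_set => /and4P[].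
apply: le_trans (_ : bern_exp q (complete_graph n) (fun H =>
    (3 * (4 * #|moved nu|) <=
      \sum_(a in shifted_pairs nu) #|a :&: moved nu| * both_in f H a)%N%:R) <= _).
  apply: ler_bern_exp => // H HK; rewrite ler_nat.
  have := overlap_le nu HK; rewrite -/f; set S := (\sum_(a in _) _)%N.
  by case: leqP => // h1 h2; case: leqP => //; lia.
apply: le_trans (bern_tail_shifted_pairs q01 qp _ _ _ th1 injf nofix) _.
rewrite ler_wpM2l // ler_wpM2l ?invr_ge0 ?exprn_ge0 ?(ltW th0) // ler_expR.
by rewrite ler_wpM2l ?sqr_ge0 // sum_shifted_pairs.
Qed.

Hypothesis n0 : (0 < n)%N.
Variable om : R.
Hypothesis omE : om = n%:R * p.
Hypothesis om1 : 1 <= om.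
Hypothesis om_small : 128 * om ^+ 8 <= n%:R.

(** With the Chernoff parameter [th = n / (om ^ 2 * sqrt e)] the exponent stays
    below [2 e], and [th ^- (4 e)] beats the number of maps that move [e]
    points. The factor [e] gained in [C(n, e) <= (4 n / e) ^ e] is essential:
    with [n ^ e] instead, the estimate would fail for [e] close to [n]. *)
Lemma displacement_term (e : nat) : (0 < e <= n)%N ->
  exists2 th : R, 1 <= th &
  'C(n, e)%:R * n%:R ^+ e *
    (3 * (th ^- (4 * e) * expR (p ^+ 2 * (e%:R * (e%:R * th ^+ 2 + n%:R * th)))))
  <= 3 * (64 * om ^+ 8 / n%:R) ^+ e.
Proof.
move=> /andP[e0 en].
have nR : 0 < n%:R :> R by rewrite ltr0n.
have eR : 1 <= e%:R :> R by rewrite ler1n.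
have enR : e%:R <= n%:R :> R by rewrite ler_nat.
have eR0 : 0 < e%:R :> R by apply: lt_le_trans eR.
have omp : p = om / n%:R by rewrite omE mulrAC mulfV ?mul1r ?gt_eqF.
have om0 : 0 < om by apply: lt_le_trans om1.
set sq := Num.sqrt (e%:R : R).
have sq2 : sq ^+ 2 = e%:R by rewrite sqr_sqrtr // ltW.
have sq1 : 1 <= sq by rewrite -sqrtr1 ler_wsqrtr.
have sq0 : 0 < sq by apply: lt_le_trans sq1.
exists (n%:R / (om ^+ 2 * sq)).
  rewrite ler_pdivlMr ?mulr_gt0 ?exprn_gt0 //. rewrite mul1r.
  rewrite -ler_sqr ?nnegrE ?mulr_ge0 ?exprn_ge0 ?(ltW om0) ?(ltW sq0) ?(ltW nR) // exprMn sq2 -exprM.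
  apply: (@le_trans _ _ (n%:R * n%:R)); last by rewrite expr2.
  apply: ler_pM => //; first by rewrite exprn_ge0 // ltW.
  apply: le_trans om_small; apply: (@le_trans _ _ (om ^+ 8)).
    by rewrite ler_weXn2l.
  by rewrite ler_peMl ?exprn_ge0 ?(ltW om0) // ler1n.
set th := _ / _.
have thV : th^-1 ^+ 4 = om ^+ 8 * e%:R ^+ 2 / n%:R ^+ 4.
  rewrite /th invf_div expr_div_n exprMn -exprM -[4%N]/(2 * 2)%N [sq ^+ _]exprM sq2.
  by [].
have exp_le : expR (p ^+ 2 * (e%:R * (e%:R * th ^+ 2 + n%:R * th))) <= 16 ^+ e.
  apply: (@le_trans _ _ (expR (e%:R * (2%:R * 1)))).
    rewrite ler_expR mulrCA ler_wpM2l ?(ltW eR0) //.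
    have -> : p ^+ 2 * (e%:R * th ^+ 2 + n%:R * th) = om ^- 2 + sq^-1.
      rewrite omp /th -sq2; field.
      by rewrite !gt_eqF.
    have : om ^- 2 <= 1 by rewrite invf_le1 ?exprn_gt0 // exprn_ege1.
    have : sq^-1 <= 1 by rewrite invf_le1.
    lra.
  rewrite expRM_natl; apply: lerXn2r; rewrite ?nnegrE ?expR_ge0 //.
  rewrite expRM_natl (_ : 16 = 4 ^+ 2) //; last by rewrite -natrX.
  by apply: lerXn2r; rewrite ?nnegrE ?expR_ge0 ?expR1_le4.
have thpos : 0 < th by rewrite divr_gt0 // mulr_gt0 ?exprn_gt0.
rewrite -exprVn mulrCA ler_wpM2l // exprM thV.
apply: (@le_trans _ _ ((4 * n%:R / e%:R) ^+ e * n%:R ^+ e *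
    ((om ^+ 8 * e%:R ^+ 2 / n%:R ^+ 4) ^+ e * 16 ^+ e))).
  have b0 : 0 <= om ^+ 8 * e%:R ^+ 2 / n%:R ^+ 4.
    by rewrite divr_ge0 ?mulr_ge0 ?exprn_ge0 ?ltW.
  apply: ler_pM.
  - by rewrite mulr_ge0 ?exprn_ge0 // ltW.
  - by rewrite mulr_ge0 ?exprn_ge0 ?expR_ge0.
  - by rewrite ler_wpM2r ?exprn_ge0 ?(ltW nR) // bin_upper_bound.
  - by rewrite ler_wpM2l ?exprn_ge0.
rewrite -!exprMn; apply: lerXn2r; rewrite ?nnegrE.
- by rewrite !(mulr_ge0, invr_ge0, exprn_ge0) // ltW.
- by rewrite !(mulr_ge0, invr_ge0, exprn_ge0) // ltW.
have -> : 4 * n%:R / e%:R * n%:R * (om ^+ 8 * e%:R ^+ 2 / n%:R ^+ 4 * 16) =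
    64 * om ^+ 8 / n%:R * (e%:R / n%:R).
  by field; rewrite !gt_eqF.
rewrite ler_piMr ?divr_ge0 ?mulr_ge0 ?exprn_ge0 ?(ltW nR) ?(ltW om0) //.
by rewrite ler_pdivrMr // mul1r.
Qed.

(** Union bound over the displacements [nu], grouped by the number of points
    that they move. *)
Lemma misleading_prob :
  bern_exp q (complete_graph n) (fun H => (misleading H)%:R) <=
  384 * om ^+ 8 / n%:R.
Proof.
have nR : 0 < n%:R :> R by rewrite ltr0n.
have om0 : 0 < om by apply: lt_le_trans om1.
pose good (nu : {ffun 'I_n -> 'I_n}) := (moved nu != set0) && dinjectiveb nu (mem (free_dom nu)).
pose ev (nu : {ffun 'I_n -> 'I_n}) H := (13 * #|moved nu| <= overlap nu H)%N.
set x := 64 * om ^+ 8 / n%:R.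
have x0 : 0 <= x by rewrite /x !(mulr_ge0, invr_ge0, exprn_ge0) // ltW.
have xle : x <= 2^-1.
  by rewrite /x ler_pdivrMr //; move: om_small; lra.
apply: (@le_trans _ _ (bern_exp q (complete_graph n) (fun H =>
    \sum_(nu | good nu) (ev nu H)%:R))).
  apply: ler_bern_exp => // H _; case: (boolP (misleading H)) => [|_]; last exact: sumr_ge0.
  case/existsP => nu /and3P[nu0 injnu le13].
  by rewrite (bigD1 nu) /good ?nu0 ?injnu //= /ev le13 lerDl sumr_ge0.
rewrite bern_exp_sum.
rewrite (partition_big (fun nu => inord #|moved nu| : 'I_n.+1) (fun e => e != ord0)) /=; last first.
  move=> nu /andP[nu0 _]; rewrite -val_eqE /= inordK ?cards_eq0 //.
  by rewrite ltnS -[X in (_ <= X)%N](card_ord n) max_card.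
apply: (@le_trans _ _ (\sum_(e < n.+1 | e != ord0) 3 * x ^+ e)); last first.
  rewrite -mulr_sumr big_mkcond big_ord_recl eqxx /= add0r.
  rewrite (_ : 384 * _ / _ = 3 * (2 * x)); last by rewrite /x; field; rewrite gt_eqF.
  rewrite ler_wpM2l //; apply: le_trans (geometric_sum_le n _); last by rewrite x0.
  by [].
apply: ler_sum => e e0.
have e_bounds : (0 < e <= n)%N by rewrite lt0n -ltnS ltn_ord andbT.
have [th th1 le_term] := displacement_term e_bounds.
apply: le_trans le_term; set B := 3 * (_ * _).
have B0 : 0 <= B.
  by rewrite /B !mulr_ge0 ?expR_ge0 // invr_ge0 exprn_ge0 // (le_trans _ th1).
apply: (@le_trans _ _ (\sum_(nu | #|moved nu| == e) B)).
  rewrite [leRHS](bigID (fun nu => good nu && (inord #|moved nu| == e))) /=.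
  rewrite -[leLHS]addr0; apply: lerD; last exact: sumr_ge0.
  have cardM (nu : {ffun 'I_n -> 'I_n}) : good nu && (inord #|moved nu| == e) -> #|moved nu| = e.
    case/andP=> _ /eqP <-; rewrite inordK //.
    by rewrite ltnS -[X in (_ <= X)%N](card_ord n) max_card.
  rewrite [leRHS](eq_bigl (fun nu => good nu && (inord #|moved nu| == e))); last first.
    by move=> nu; apply/andP/idP => [[]//|g]; split=> //; apply/eqP/cardM.
  apply: ler_sum => nu gnu; have cM := cardM nu gnu; move: gnu => /andP[/andP[nu0 /dinjectiveP injnu] _].
  by have := overlap_tail th1 injnu; rewrite /B /ev cM.
rewrite sumr_const -[leLHS]mulr_natl ler_wpM2r // -natrX -natrM ler_nat -[X in (X <= _)%N]cardsE.
exact: card_moved.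
Qed.

End MisleadingProbability.

(** If [mu] disagreed with [pi] somewhere on [M], then [pi^-1 \o mu] on [M],
    extended by the identity, would witness that [G] is misleading: its moved
    points are the errors, and [M] lies in its free domain. *)
Lemma matching_correct (n : nat) (G G1 G2 : graph n) (pi : 'S_n) (m : pre_matching n) :
  G1 \subset G -> G2 \subset G -> ~~ misleading G ->
  is_kcore_matching 13 G1 (relabel pi G2) m ->
  restr_graph m.2 m.1 = restr_graph pi m.1.
Proof.
case: m => M mu /= /subsetP G1G /subsetP G2G notbad [injmu degM]; rewrite /= in injmu degM.
pose nu : {ffun 'I_n -> 'I_n} := [ffun i => if i \in M then (pi^-1)%g (mu i) else i].
have nuE i : i \in M -> pi (nu i) = mu i by move=> iM; rewrite ffunE iM permKV.
have injM : {in M &, injective nu}.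
  by move=> i j iM jM eq_ij; apply: injmu; rewrite // -!nuE // eq_ij.
have movedM i : i \in moved nu -> i \in M.
  by rewrite in_set ffunE; case: ifP => //; rewrite eqxx.
have Mfree i : i \in M -> i \in free_dom nu.
  move=> iM; rewrite in_setU in_setC; have [//|inm] := boolP (i \in moved nu).
  apply/imsetP => -[j jm ij]; move: (inm); rewrite in_set negbK => /eqP nui.
  have eq_ij : i = j by apply: injM; [exact: iM | exact: movedM | rewrite nui].
  by rewrite eq_ij jm in inm.
have injfree : {in free_dom nu &, injective nu}.
  have cross i j : i \in moved nu -> j \in free_dom nu -> j \notin moved nu -> nu i != nu j.
    move=> im; rewrite in_setU => /orP[->//|]; rewrite in_setC => jim jm.
    move: jm; rewrite in_set negbK => /eqP ->; apply: contraNneq jim => <-.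
    exact: imset_f.
  move=> i j ifr jfr eq_ij.
  have [im|im] := boolP (i \in moved nu); have [jm|jm] := boolP (j \in moved nu).
  - by apply: injM => //; apply: movedM.
  - by have := cross i j im jfr jm; rewrite eq_ij eqxx.
  - by have := cross j i jm ifr im; rewrite eq_ij eqxx.
  - by move: im jm eq_ij; rewrite !in_set !negbK => /eqP-> /eqP->.
have nomoved : moved nu = set0.
  apply/eqP; apply: contraNT notbad => nu0; apply/existsP; exists nu.
  rewrite nu0 /=; apply/andP; split; first exact/dinjectiveP.
  rewrite /overlap mulnC -sum_nat_const; apply: leq_sum => i im.
  have iM := movedM i im.
  apply: leq_trans (degM i iM) _; apply/subset_leq_card/subsetP => j.
  rewrite in_set /adj in_set /= => /and3P[/subsetP ijM ijG1 /imsetP[e eG2 eq_e]].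
  have jM : j \in M by apply: ijM; rewrite in_set2 eqxx orbT.
  rewrite in_set Mfree // G1G //=; suff -> : [set nu i; nu j] = e by apply: G2G.
  apply: (imset_inj (@perm_inj _ pi)); rewrite -eq_e.
  by rewrite !imsetU1 !imset_set1 !nuE.
apply: eq_in_imset => i iM; congr (_, _); rewrite -nuE //; congr (pi _).
by apply/eqP/negPn; have := in_set0 i; rewrite -nomoved in_set => ->.
Qed.

(** * Sparse small sets force a large core *)

Section LargeCore.
Variable n : nat.
Implicit Types (H : graph n) (U S : {set 'I_n}).

Definition low_deg H : {set 'I_n} := [set i | (degree H i < 21)%N].

Definition edges_in H U : {set {set 'I_n}} := [set a in H | a \subset U].

Definition has_core (m : nat) H : bool :=
  [exists S : {set 'I_n}, (n <= #|S| + m)%N &&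
    [forall i in S, (13 <= #|[set j in S | adj H i j]|)%N]].

Lemma edges_inU1 H U i : i \notin U ->
  (#|edges_in H U| + #|[set j in U | adj H i j]| <= #|edges_in H (i |: U)|)%N.
Proof.
move=> iU; rewrite -(card_imset _ (@set2_inj n i)).
set A := edges_in H U; set B := _ @: _.
have disj : A :&: B = set0.
  apply/setP => a; rewrite in_setI in_set0; apply/negP => /andP[].
  rewrite in_set => /andP[_ aU] /imsetP[j _ a_eq]; move: aU.
  by rewrite a_eq subUset sub1set (negPf iU).
have -> : (#|A| + #|B| = #|A :|: B|)%N by rewrite cardsU disj cards0 subn0.
apply/subset_leq_card/subsetP => a; rewrite in_setU !in_set => /orP[/andP[-> aU]|].
  exact: subset_trans aU (subsetUr _ _).
case/imsetP => j; rewrite in_set => /andP[jU ijH] ->; move: ijH; rewrite /adj => ->.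
by rewrite subUset !sub1set !inE eqxx jU orbT.
Qed.

(** Start from the vertices of degree below [21] and keep absorbing a vertex
    with at most [12] neighbours outside: each absorbed vertex brings at least
    [9] new inner edges. If the process reached size [m], two thirds of the set
    would have been absorbed, giving [6 m] inner edges. *)
Lemma core_of_sparse (m : nat) H :
  (3 * #|low_deg H| <= m)%N ->
  (forall U, #|U| = m -> (#|edges_in H U| < 6 * m)%N) -> has_core m H.
Proof.
move=> low_m sparse.
suff grow k U : (m - #|U| < k)%N -> low_deg H \subset U -> (#|U| <= m)%N ->
    (9 * (#|U| - #|low_deg H|) <= #|edges_in H U|)%N -> has_core m H.
  by apply: (grow _ (low_deg H) (ltnSn _)) => //; lia.
elim: k U => // k IH U ltk lowU Um eU.
have lowcard := subset_leq_card lowU.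
have [eqUm|neUm] := eqVneq #|U| m.
  by have := sparse U eqUm; lia.
have [ok|] := boolP [forall i in ~: U, (13 <= #|[set j in ~: U | adj H i j]|)%N].
  apply/existsP; exists (~: U); rewrite ok andbT.
  by have := cardsC U; rewrite card_ord; lia.
rewrite negb_forall => /existsP[i]; rewrite negb_imply in_setC -ltnNge => /andP[iU lt13].
have degi : (21 <= degree H i)%N.
  by rewrite leqNgt; apply: contra iU => lt21; apply: (subsetP lowU); rewrite in_set.
have split : (degree H i = #|[set j in U | adj H i j]| + #|[set j in ~: U | adj H i j]|)%N.
  rewrite /degree -(cardsID U [set j | adj H i j]).
  by congr (_ + _)%N; apply: eq_card => j; rewrite !inE // andbC.
have eU1 := edges_inU1 H iU.
have cU1 : #|i |: U| = #|U|.+1 by rewrite cardsU1 iU.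
apply: (IH (i |: U)).
- by rewrite cU1; lia.
- exact: subset_trans lowU (subsetUr _ _).
- by rewrite cU1; lia.
- by rewrite cU1; lia.
Qed.

Lemma degree_edges H i : H \subset complete_graph n ->
  degree H i = #|[set a in H | i \in a]|.
Proof.
move=> /subsetP HK; rewrite /degree -(card_imset _ (@set2_inj n i)).
apply: eq_card => a; apply/imsetP/idP => [[j]|].
  by rewrite !in_set /adj => ijH ->; rewrite ijH !inE eqxx.
rewrite in_set => /andP[aH ia]; have := HK a aH; rewrite in_set => /cards2P[x [y [_ a_eq]]].
move: ia aH; rewrite a_eq in_set2 => /orP[]/eqP-> aH.
  by exists y; rewrite // in_set.
by exists x; rewrite ?in_set /adj setUC.
Qed.

(** Adding an edge changes only the degrees of its two ends. *)
Lemma low_deg_lipschitz (R : realType) (e : {set 'I_n}) H : e \in complete_graph n ->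
  `|#|low_deg (e |: H)|%:R - #|low_deg H|%:R| <= 2 :> R.
Proof.
rewrite in_set => /eqP e2'; have e2 : #|e| = 2%N by [].
have same i : i \notin e -> degree (e |: H) i = degree H i.
  move=> ie; apply: eq_card => j; rewrite !in_set /adj in_setU1; case: eqP => //= e_eq.
  by rewrite -e_eq !inE eqxx in ie.
have sub A B : (forall i, i \notin e -> degree A i = degree B i) ->
    (#|low_deg A| <= #|low_deg B| + 2)%N.
  move=> sameAB; rewrite -e2; apply: leq_trans (leq_card_setU _ _).
  apply/subset_leq_card/subsetP => i; rewrite in_setU in_set => iA.
  by have [|ie] := boolP (i \in e); rewrite ?orbT // orbF in_set -sameAB.
have h1 := sub _ _ same; have h2 : (#|low_deg H| <= #|low_deg (e |: H)| + 2)%N.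
  by apply: sub => i /same.
have : #|low_deg (e |: H)|%:R <= #|low_deg H|%:R + 2 :> R by rewrite -natrD ler_nat.
have : #|low_deg H|%:R <= #|low_deg (e |: H)|%:R + 2 :> R by rewrite -natrD ler_nat.
by rewrite ler_norml; lra.
Qed.

End LargeCore.

Section CoreProbability.
Variables (R : realType) (n : nat) (q : {set 'I_n} -> R).
Hypothesis q01 : forall e, 0 <= q e <= 1.

Lemma sum_star (i : 'I_n) :
  \sum_(a in complete_graph n | i \in a) q a = \sum_(j | j != i) q [set i; j].
Proof.
rewrite -(big_imset q (h := fun j => [set i; j]) (A := [pred j | j != i])) /=; last first.
  by move=> j k _ _; apply: set2_inj.
apply: eq_bigl => a; apply/andP/imsetP => [[]|[j ji ->]].
  rewrite in_set => /cards2P[x [y [xy ->]]]; rewrite in_set2 => /orP[]/eqP->.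
    by exists y; rewrite // inE eq_sym.
  by exists x; rewrite // setUC.
rewrite inE in ji; split; last by rewrite in_set2 eqxx.
by rewrite in_set cards2 eq_sym [i == j]eq_sym ji.
Qed.

(** Markov's inequality for [2 ^ - degree]. *)
Lemma low_degree_prob (i : 'I_n) (mu : R) :
  mu <= \sum_(j | j != i) q [set i; j] ->
  bern_exp q (complete_graph n) (fun H => (degree H i < 21)%N%:R) <=
  2 ^+ 21 * expR (- (mu / 2)).
Proof.
move=> le_mu; pose t (a : {set 'I_n}) : R := if i \in a then 2^-1 else 1.
apply: (@le_trans _ _ (bern_exp q (complete_graph n)
    (fun H => 2 ^+ 21 * \prod_(a in H) t a))).
  apply: ler_bern_exp => // H HK.
  have -> : \prod_(a in H) t a = 2^-1 ^+ degree H i.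
    rewrite (degree_edges i HK) -prodr_const /t -big_mkcondr /=.
    by apply: eq_bigl => a; rewrite in_set.
  case: ltnP => [lt21|_]; last by rewrite mulr_ge0 ?exprn_ge0 ?invr_ge0.
  rewrite exprVn ler_pdivlMr ?exprn_gt0 // mul1r ler_weXn2l ?ler1n //.
  exact: ltnW.
rewrite bern_expZ ler_wpM2l ?exprn_ge0 // bern_exp_prod.
apply: (@le_trans _ _ (\prod_(a in complete_graph n) expR (- (if i \in a then q a / 2 else 0)))).
  apply: ler_prod => a _; have /andP[q0 q1] := q01 a; rewrite /t; case: ifP => _.
    apply/andP; split; first lra.
    by apply: le_trans (expR_ge1Dx _); lra.
  by rewrite oppr0 expR0 mulr1 subrK ler01 lexx.
rewrite -expR_sum ler_expR sumrN lerN2 -big_mkcondr /= -mulr_suml.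
by rewrite ler_wpM2r ?invr_ge0 // sum_star.
Qed.

Variable lam : R.
Hypothesis n0 : (0 < n)%N.
Hypothesis q_lam : forall e, q e <= lam / n%:R.

(** Union bound over the sets [U] of size [m], with Markov's inequality for
    [z ^ (number of edges inside U)]. *)
Lemma sparse_prob (m : nat) (z : R) : (0 < m <= n)%N -> 1 <= z ->
  lam * z * m%:R <= n%:R -> 
  bern_exp q (complete_graph n)
    (fun H => [exists U : {set 'I_n}, (#|U| == m) && (6 * m <= #|edges_in H U|)%N]%:R)
  <= (16 * (n%:R / m%:R) / z ^+ 6) ^+ m.
Proof.
move=> /andP[m0 mn] z1 zm; set K := complete_graph n.
have z0 : 0 < z by apply: lt_le_trans z1.
have mR : 0 < m%:R :> R by rewrite ltr0n.
have nR : 0 < n%:R :> R by rewrite ltr0n.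
apply: (@le_trans _ _ (bern_exp q K (fun H =>
   \sum_(U : {set 'I_n} | #|U| == m) (6 * m <= #|edges_in H U|)%N%:R))).
  apply: ler_bern_exp => // H _; case: (boolP [exists U : {set 'I_n}, _]) => [|_]; last exact: sumr_ge0.
  by case/existsP => U /andP[cU eU]; rewrite (bigD1 U) //= eU lerDl sumr_ge0.
rewrite bern_exp_sum.
apply: (@le_trans _ _ (\sum_(U : {set 'I_n} | #|U| == m) z ^- (6 * m) * 4 ^+ m)).
  apply: ler_sum => U /eqP cU.
  pose t (a : {set 'I_n}) : R := if a \subset U then z else 1.
  apply: (@le_trans _ _ (bern_exp q K (fun H => z ^- (6 * m) * \prod_(a in H) t a))).
    apply: ler_bern_exp => // H _.
    have -> : \prod_(a in H) t a = z ^+ #|edges_in H U|.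
      by rewrite -prodr_const /t -big_mkcondr /=; apply: eq_bigl => a; rewrite in_set.
    case: leqP => [le6|_]; last by rewrite mulr_ge0 ?invr_ge0 ?exprn_ge0 // ltW.
    by rewrite mulrC ler_pdivlMr ?exprn_gt0 // mul1r ler_weXn2l.
  rewrite bern_expZ ler_wpM2l ?invr_ge0 ?exprn_ge0 ?(ltW z0) // bern_exp_prod.
  have lam0 : 0 <= lam / n%:R.
    by have /andP[q0 _] := q01 set0; apply: le_trans q0 (q_lam _).
  apply: (@le_trans _ _ (\prod_(a in K) expR (if a \subset U then lam / n%:R * z else 0))).
    apply: ler_prod => a _; have /andP[q0 q1] := q01 a; rewrite /t; case: ifP => _.
      have qz : 0 <= q a * z by rewrite mulr_ge0 // ltW.
      apply/andP; split; first lra.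
      apply: le_trans (expR_ge1Dx _).
      have : q a * z <= lam / n%:R * z by rewrite ler_wpM2r // ltW.
      lra.
    by rewrite expR0 mulr1 subrK ler01 lexx.
  rewrite -expR_sum -big_mkcondr /= sumr_const.
  apply: (@le_trans _ _ (expR m%:R)); last first.
    rewrite -[m%:R]mulr1 expRM_natl; apply: lerXn2r; rewrite ?nnegrE ?expR_ge0 //.
    exact: expR1_le4.
  rewrite ler_expR -[leLHS]mulr_natl.
  apply: (@le_trans _ _ ((m * m)%N%:R * (lam / n%:R * z))).
    apply: ler_wpM2r; first by rewrite mulr_ge0 // ltW.
    rewrite ler_nat.
    rewrite (_ : #|_| = 'C(m, 2)); last first.
      rewrite -cU -cards_draws; apply: eq_card => a; rewrite in_set andbC.
      by rewrite unfold_in /= in_set.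
    exact: bin2_le.
  rewrite natrM -mulrA ler_piMr ?(ltW mR) //.
  rewrite (_ : _ * _ = lam * z * m%:R / n%:R); last by field; rewrite gt_eqF.
  by rewrite ler_pdivrMr // mul1r.
rewrite sumr_const -[leLHS]mulr_natl -[X in X%:R]cardsE card_draws card_ord.
have := bin_upper_bound R n m0; set c := 'C(n, m)%:R => c_le.
have -> : (16 * (n%:R / m%:R) / z ^+ 6) ^+ m =
    (4 * n%:R / m%:R) ^+ m * (z ^- (6 * m) * 4 ^+ m).
  rewrite (_ : z ^- (6 * m) = (z ^- 6) ^+ m); last by rewrite exprM exprVn.
  rewrite -!exprMn; congr (_ ^+ _); field.
  by rewrite !gt_eqF.
by rewrite ler_wpM2r // mulr_ge0 ?invr_ge0 ?exprn_ge0 // ltW.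
Qed.

End CoreProbability.

(** * Size of the core *)

Lemma expR_nat_lower (R : realType) (k : nat) : 2 ^+ k <= expR k%:R :> R.
Proof.
rewrite -[X in expR X]mulr1 expRM_natl; apply: lerXn2r; rewrite ?nnegrE ?expR_ge0 //.
by have := expR_ge1Dx (1 : R); lra.
Qed.

(** The left side is largest when [lam = u ^ 2] and [b = exp (- (u / 7))], and
    then it decreases in [u] beyond [154]: here the constant [154 = 7 * 22]
    enters, through [154 ^ 2 <= 2 ^ 15] and [exp (- 22) <= 2 ^ - 22]. Writing [w = exp ((u - 154) / 154)] keeps track of
    larger [u], as [u <= 154 * w]. *)
Lemma core_numerics (R : realType) (u lam b : R) :
  154 <= u -> 0 <= lam <= u ^+ 2 -> 0 <= b <= expR (- (u / 7)) ->
  32 * lam * (8 * b * lam) ^+ 5 <= 1.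
Proof.
move=> u154 /andP[lam0 lamu] /andP[b0 bu].
set w := expR ((u - 154) / 154).
have w1 : 1 <= w.
  by rewrite /w -[X in X <= _]expR0 ler_expR divr_ge0 // subr_ge0.
have w0 : 0 < w by apply: lt_le_trans w1.
have uw : u <= 154 * w.
  have := expR_ge1Dx ((u - 154) / 154); rewrite -/w; lra.
have lamw : lam <= 2 ^+ 15 * w ^+ 2.
  apply: le_trans lamu _; apply: (@le_trans _ _ ((154 * w) ^+ 2)).
    by apply: lerXn2r; rewrite ?nnegrE ?mulr_ge0 ?(ltW w0) //; lra.
  rewrite exprMn ler_wpM2r ?exprn_ge0 ?(ltW w0) // -!natrX ler_nat.
  by [].
have bw : b * (2 ^+ 22 * w ^+ 4) <= 1.
  apply: (@le_trans _ _ (expR (- (u / 7)) * (expR 22%:R * expR (4%:R * ((u - 154) / 154))))).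
    apply: ler_pM => //; first by rewrite mulr_ge0 ?exprn_ge0 // ltW.
    rewrite expRM_natl -/w ler_wpM2r ?exprn_ge0 ?(ltW w0) //.
    exact: expR_nat_lower.
  by rewrite -!expRD -[leRHS]expR0 ler_expR; lra.
have y_le : 8 * b * lam * (2 ^+ 4 * w ^+ 2) <= 1.
  apply: le_trans bw.
  apply: (@le_trans _ _ (8 * b * (2 ^+ 15 * w ^+ 2) * (2 ^+ 4 * w ^+ 2))).
    rewrite ler_wpM2r ?mulr_ge0 ?exprn_ge0 ?(ltW w0) //.
    by rewrite ler_wpM2l // mulr_ge0.
  by rewrite le_eqVlt; apply/orP; left; apply/eqP; ring.
have y0 : 0 <= 8 * b * lam by rewrite !mulr_ge0.
set y := 8 * b * lam in y_le y0 *.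
have yV : y <= (2 ^+ 4 * w ^+ 2)^-1.
  by rewrite -[leRHS]mul1r ler_pdivlMr // mulr_gt0 ?exprn_gt0.
apply: (@le_trans _ _ (32 * (2 ^+ 15 * w ^+ 2) * (2 ^+ 4 * w ^+ 2)^-1 ^+ 5)).
  apply: ler_pM; rewrite ?mulr_ge0 ?exprn_ge0 //.
    by rewrite ler_wpM2l.
  by apply: lerXn2r; rewrite ?nnegrE ?invr_ge0 ?mulr_ge0 ?exprn_ge0 ?(ltW w0).
rewrite exprVn ler_pdivrMr ?exprn_gt0 ?mulr_gt0 ?exprn_gt0 // mul1r.
rewrite [leRHS]exprMn mulrA ler_pM ?mulr_ge0 ?exprn_ge0 ?(ltW w0) //.
  by rewrite -exprM (_ : 32 = 2 ^+ 5) -?exprD // -natrX.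
by rewrite -exprM ler_weXn2l.
Qed.

Section CoreEstimate.
Variables (R : realType) (n : nat) (q : {set 'I_n} -> R) (lam u Delta h : R).
Hypothesis q01 : forall e, 0 <= q e <= 1.
Hypothesis n0 : (0 < n)%N.
Hypothesis q_lam : forall e, q e <= lam / n%:R.
Hypothesis h100 : 100 <= h.
Hypothesis h4 : h ^+ 4 = n%:R.
Hypothesis lam1 : 1 <= lam.
Hypothesis lam_h : lam ^+ 4 <= h.
Hypothesis u154 : 154 <= u.
Hypothesis lam_u : lam <= u ^+ 2.
Hypothesis u_Delta : u <= 7 * Delta.
Hypothesis deg_Delta : forall i : 'I_n, 7 * Delta <= \sum_(j | j != i) q [set i; j].
Let K := complete_graph n.
Let b := expR (- Delta).

(** The Markov bound [2 ^ 21 * exp (- 7 Delta / 2)] for one vertex is below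
    [exp (- Delta)], since [Delta >= 22]. *)
Lemma expected_low_deg :
  bern_exp q K (fun H => #|low_deg H|%:R) <= b * n%:R.
Proof.
rewrite (@bern_exp_supp _ _ _ _ _
  (fun H => \sum_(i < n) (degree H i < 21)%N%:R)); last first.
  move=> H _; rewrite -natr_sum -sum1_card big_mkcond; congr (_%:R).
  by apply: eq_bigr => i _; rewrite in_set; case: ifP.
rewrite bern_exp_sum mulr_natr -[n in leRHS]card_ord -sumr_const.
apply: ler_sum => i _; apply: le_trans (low_degree_prob q01 (deg_Delta i)) _.
apply: (@le_trans _ _ (expR 21%:R * expR (- (7 * Delta / 2)))).
  by rewrite ler_wpM2r ?expR_ge0 // expR_nat_lower.
rewrite -expRD ler_expR; move: u154 u_Delta; lra.
Qed.

(** Markov's inequality would not give a probability tending to [0] when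
    [Delta] is bounded, hence the variance. *)
Lemma many_low_deg_prob :
  bern_exp q K (fun H => (b * n%:R + n%:R / h <= #|low_deg H|%:R)%R%:R) <= 4 / h.
Proof.
have h0 : 0 < h by apply: lt_le_trans h100.
have nR : 0 < n%:R :> R by rewrite ltr0n.
have tau0 : 0 < n%:R / h by rewrite divr_gt0.
have lip e (H : graph n) : e \in K -> `|#|low_deg (e |: H)|%:R - #|low_deg H|%:R| <= 2 :> R.
  exact: low_deg_lipschitz.
apply: (@le_trans _ _ (bern_exp q K (fun H =>
   (bern_exp q K (fun H => #|low_deg H|%:R) + n%:R / h <= #|low_deg H|%:R)%R%:R))).
  apply: ler_bern_exp => // H _; rewrite ler_nat.
  case: (boolP (b * n%:R + n%:R / h <= #|low_deg H|%:R)) => // le_low.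
  by rewrite (le_trans _ le_low) // lerD2r expected_low_deg.
apply: le_trans (bern_chebyshev q01 _ lip tau0) _ => //.
have sum_q : \sum_(e in K) q e <= n%:R * lam.
  apply: (@le_trans _ _ (\sum_(e in K) lam / n%:R)); first exact: ler_sum.
  rewrite sumr_const -[leLHS]mulr_natl.
  apply: (@le_trans _ _ ((n * n)%N%:R * (lam / n%:R))).
    apply: ler_wpM2r; first by rewrite divr_ge0 // (le_trans _ lam1).
    rewrite ler_nat (card_draws 'I_n 2) card_ord.
    exact: bin2_le.
  by rewrite le_eqVlt; apply/orP; left; apply/eqP; rewrite natrM; field; rewrite gt_eqF.
rewrite ler_pdivrMr ?exprn_gt0 //.
apply: (@le_trans _ _ (2 ^+ 2 * (n%:R * lam))); first by rewrite ler_wpM2l ?sqr_ge0.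
have lamh : lam <= h by apply: le_trans lam_h; rewrite -[leLHS]expr1 ler_weXn2l.
rewrite (_ : _ / _ * _ = 2 ^+ 2 * (n%:R * h)).
  by rewrite ler_wpM2l // ler_wpM2l.
by rewrite -h4; field; rewrite gt_eqF.
Qed.

(** The set absorbed in [core_of_sparse] is at most three times as large as the
    set of low-degree vertices, whence the factor [3]. *)
Lemma core_prob : exists2 m : nat,
  m%:R <= 3 * b * n%:R + 3 * (n%:R / h) + 1 &
  bern_exp q K (fun H => (~~ has_core m H)%:R) <= 5 / h.
Proof.
have h0 : 0 < h by apply: lt_le_trans h100.
have nR : 0 < n%:R :> R by rewrite ltr0n.
have b0 : 0 < b by apply: expR_gt0.
have lam0 : 0 < lam by apply: lt_le_trans lam1.
have nh : n%:R / h = h ^+ 3 by rewrite -h4; field; rewrite gt_eqF.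
have h3 : 100 ^+ 3 <= h ^+ 3 by apply: lerXn2r; rewrite ?nnegrE // ltW.
set x := 3 * b * n%:R + 3 * (n%:R / h).
have x0 : 0 <= x by rewrite addr_ge0 // !mulr_ge0 // ?invr_ge0 ltW.
exists (Num.truncn x).+1.
  by rewrite -natr1 lerD2r truncn_le.
set m := (Num.truncn x).+1; have xm : x < m%:R := truncnS_gt x.
have mx : m%:R <= x + 1 by rewrite /m -natr1 lerD2r truncn_le.
have m0 : (0 < m)%N by [].
have mR : 0 < m%:R :> R by rewrite ltr0n.
pose rho : R := m%:R / n%:R.
have rho0 : 0 < rho by rewrite divr_gt0.
have key : 32 * lam * (rho * lam) ^+ 5 <= 1.
  (* Either [b * n] dominates [m], and [core_numerics] applies, or the error
     term [n / h] does, and then [lam] is negligible against [h]. *)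
  have [big|small] := lerP 1 (b * h).
    have rho_b : rho <= 8 * b.
      rewrite ler_pdivrMr //; apply: le_trans mx _; rewrite /x.
      have : n%:R / h <= b * n%:R.
        by rewrite ler_pdivrMr // mulrAC ler_peMl // ltW.
      by move: h3; rewrite -nh; lra.
    have num : 32 * lam * (8 * b * lam) ^+ 5 <= 1.
      apply: (core_numerics u154); first by rewrite (ltW lam0).
      by rewrite (ltW b0) ler_expR lerN2 ler_pdivrMr // mulrC.
    apply: le_trans num; rewrite ler_wpM2l ?mulr_ge0 ?(ltW lam0) //.
    apply: lerXn2r; rewrite ?nnegrE ?mulr_ge0 ?(ltW lam0) ?(ltW rho0) ?(ltW b0) //.
    by rewrite ler_wpM2r // ltW.
  have rho_h : rho <= 7 / h.
    rewrite ler_pdivrMr // -mulrA [h^-1 * _]mulrC; apply: le_trans mx _; rewrite /x.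
    have : b * n%:R <= n%:R / h.
      by rewrite ler_pdivlMr // mulrAC ler_piMl // ltW.
    by move: h3; rewrite -nh; lra.
  apply: (@le_trans _ _ (32 * lam * (7 / h * lam) ^+ 5)).
    rewrite ler_wpM2l ?mulr_ge0 ?(ltW lam0) //.
    apply: lerXn2r; rewrite ?nnegrE ?mulr_ge0 ?invr_ge0 ?(ltW lam0) ?(ltW rho0) ?(ltW h0) //.
    by rewrite ler_wpM2r // ltW.
  rewrite (_ : _ * _ = 32 * 7 ^+ 5 * lam ^+ 6 / h ^+ 5); last first.
    by field; rewrite gt_eqF.
  rewrite ler_pdivrMr ?exprn_gt0 // mul1r.
  have lam6 : lam ^+ 6 <= h ^+ 2.
    apply: (@le_trans _ _ ((lam ^+ 4) ^+ 2)); first by rewrite -exprM ler_weXn2l.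
    by apply: lerXn2r; rewrite ?nnegrE ?exprn_ge0 // ltW.
  rewrite (_ : h ^+ 5 = h ^+ 3 * h ^+ 2); last by rewrite -exprD.
  apply: ler_pM => //; rewrite ?exprn_ge0 ?(ltW lam0) //.
  by apply: le_trans h3; lra.
have rholam1 : rho * lam <= 1.
  rewrite leNgt; apply/negP => gt1; move: key; apply/negP; rewrite -ltNge.
  have : 1 < (rho * lam) ^+ 5 by rewrite exprn_egt1.
  by move: lam1; nra.
(* With [z = 1 / (rho * lam)] the expectation of [z ^ (number of edges inside U)]
   is at most [exp m] for every [U] of size [m]. *)
have z1 : 1 <= (rho * lam)^-1 by rewrite invf_ge1 // mulr_gt0.
have mn : (m <= n)%N.
  rewrite -(ler_nat R) -[leRHS]mul1r -ler_pdivrMr //.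
  by apply: le_trans rholam1; rewrite ler_peMr // ltW.
have zm : lam * (rho * lam)^-1 * m%:R <= n%:R.
  by rewrite le_eqVlt; apply/orP; left; apply/eqP; rewrite /rho; field; rewrite !gt_eqF.
have m_range : (0 < m <= n)%N by rewrite m0.
have sp := sparse_prob q01 n0 q_lam m_range z1 zm.
set P2 := bern_exp _ _ _ in sp.
apply: (@le_trans _ _ (bern_exp q K (fun H =>
   (b * n%:R + n%:R / h <= #|low_deg H|%:R)%R%:R) + P2)).
  rewrite /P2 -bern_expD; apply: ler_bern_exp => // H _.
  case: (boolP (b * n%:R + n%:R / h <= #|low_deg H|%:R)) => [_|few].
    by case: has_core; rewrite /= ?addr_ge0 ?lerDl.
  case: (boolP [exists U : {set 'I_n}, _]) => [_|none].
    by rewrite add0r; case: has_core.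
  suff -> : has_core m H by rewrite addr0.
  apply: core_of_sparse.
    rewrite leqNgt; apply: contra few => few.
    have : m%:R <= 3 * #|low_deg H|%:R :> R by rewrite -natrM ler_nat ltnW.
    by move: xm; rewrite /x; lra.
  move=> U cU; rewrite ltnNge; apply: contra none => le6.
  by apply/existsP; exists U; rewrite cU eqxx.
rewrite (_ : 5 / h = 4 / h + 1 / h); last by rewrite -mulrDl; congr (_ / _); lra.
apply: lerD; first exact: many_low_deg_prob.
apply: le_trans sp _.
apply: (@le_trans _ _ (2^-1 ^+ m)).
  apply: lerXn2r; rewrite ?nnegrE ?invr_ge0 //.
    by rewrite !mulr_ge0 ?invr_ge0 ?exprn_ge0 ?invr_ge0 ?mulr_ge0 // ltW.
  rewrite (_ : _ / _ = 16 * lam * (rho * lam) ^+ 5); last first.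
    by rewrite /rho; field; rewrite !gt_eqF.
  by move: key; set y := _ ^+ 5; lra.
rewrite mul1r exprVn lef_pV2 ?posrE ?exprn_gt0 //.
apply: (@le_trans _ _ m%:R); last by rewrite -natrX ler_nat ltnW // ltn_expl.
apply: le_trans (ltW xm); apply: (@le_trans _ _ (h ^+ 3)).
  rewrite -[leLHS]expr1 ler_weXn2l //; apply: le_trans h100.
  by rewrite ler1n.
rewrite /x nh; have : 0 <= 3 * b * n%:R by rewrite !mulr_ge0 // ltW.
by move: h3; lra.
Qed.

End CoreEstimate.

(** * The law of the correlated graphs *)

Section Reduction.
Variables (R : realType) (n : nat).
Implicit Types (G H : graph n).

(** Products over ordered pairs [i < j] become products over two-element sets. *)
Lemma subgraph_pmfE (q : 'I_n -> 'I_n -> R) (Q : {set 'I_n} -> R) G H :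
  (forall i j, i != j -> Q [set i; j] = q i j) -> G \subset complete_graph n ->
  subgraph_pmf G q H = bern_pmf Q G H.
Proof.
move=> QE /subsetP GK; rewrite /subgraph_pmf /bern_pmf; case: ifP => // _.
rewrite pair_big_dep /=.
pose h (x : 'I_n * 'I_n) := [set x.1; x.2].
pose A := [set x : 'I_n * 'I_n | (x.1 < x.2)%N && adj G x.1 x.2].
have injh : {in A &, injective h}.
  move=> [i j] [k l]; rewrite !in_set /h /= => /andP[ij _] /andP[kl _] eq_h.
  have : i \in [set k; l] by rewrite -eq_h !inE eqxx.
  have : j \in [set k; l] by rewrite -eq_h !inE eqxx orbT.
  by rewrite !in_set2 => /orP[]/eqP jE /orP[]/eqP iE; subst => //; move: ij kl; lia.
have GE : G = h @: A.
  apply/setP => a; apply/idP/imsetP => [aG|[[i j]]]; last first.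
    by rewrite in_set => /andP[_ ijG] ->.
  have := GK a aG; rewrite in_set => /cards2P[i [j [ij a_eq]]].
  have [lt_ij|le_ji] := ltnP i j.
    by exists (i, j); rewrite // in_set /= lt_ij /adj -a_eq.
  exists (j, i); rewrite /h /= 1?setUC // in_set /= /adj setUC -a_eq aG andbT.
  by rewrite ltn_neqAle le_ji eq_sym andbT.
rewrite [in RHS]GE big_imset //=.
rewrite [RHS](eq_bigl (fun x : 'I_n * 'I_n => (x.1 < x.2)%N && adj G x.1 x.2)); last first.
  by move=> x; rewrite in_set.
apply: eq_bigr => -[i j] /= /andP[ij _]; rewrite /adj QE //.
by rewrite -val_eqE /= neq_ltn ij.
Qed.

Variables (d : nat) (x : 'I_n -> 'rV[R]_d) (r p s : R).
Hypothesis p01 : 0 <= p <= 1.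
Hypothesis s01 : 0 <= s <= 1.
Let K := complete_graph n.

(** [edge_prob] as a function of unordered pairs; which of the two orders is
    picked does not matter, by symmetry. *)
Definition pair_weight (a : {set 'I_n}) : R :=
  if [pick ij : 'I_n * 'I_n | a == [set ij.1; ij.2]] is Some ij
  then edge_prob x r p ij.1 ij.2 else 0.

Lemma edge_prob_sym i j : edge_prob x r p i j = edge_prob x r p j i.
Proof.
rewrite /edge_prob eq_sym; congr (if _ && (_ <= _) then _ else _).
rewrite /l2norm; congr (Num.sqrt _); apply: eq_bigr => k _.
by rewrite !mxE -sqrrN opprB.
Qed.

Lemma pair_weightE i j : pair_weight [set i; j] = edge_prob x r p i j.
Proof.
rewrite /pair_weight; case: pickP => [[k l] /= /eqP eq_kl|/(_ (i, j))]; last by rewrite eqxx.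
have : k \in [set i; j] by rewrite eq_kl in_set2 eqxx.
rewrite in_set2 => /orP[]/eqP k_eq; move: eq_kl; rewrite k_eq.
  by move/set2_inj => <-.
by rewrite setUC => /set2_inj <-; exact: edge_prob_sym.
Qed.

Lemma pair_weight_bounds a : 0 <= pair_weight a <= p.
Proof.
have /andP[p0 _] := p01.
by rewrite /pair_weight /edge_prob; case: pickP => [[i j] _|_]; [case: ifP|]; rewrite ?lexx ?p0.
Qed.

Lemma pair_weight01 a : 0 <= pair_weight a <= 1.
Proof.
have /andP[w0 wp] := pair_weight_bounds a; have /andP[_ p1] := p01.
by rewrite w0 (le_trans wp).
Qed.

Lemma corr_pmfE (G G1 G2 : graph n) (pi : 'S_n) :
  corr_pmf x r p s (G, G1, G2, pi) =
  bern_pmf pair_weight K G * bern_pmf (fun=> s) G G1 * bern_pmf (fun=> s) G G2 / n`!%:R.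
Proof.
rewrite /corr_pmf (subgraph_pmfE (Q := pair_weight)) //; last first.
  by move=> i j _; exact: pair_weightE.
have [GK|GK] := boolP (G \subset K); last by rewrite /bern_pmf (negPf GK) !mul0r.
by rewrite !(subgraph_pmfE (Q := fun=> s)).
Qed.

Lemma corr_exp (F : graph n -> graph n -> graph n -> R) :
  \sum_(w : outcome n) corr_pmf x r p s w * F w.1.1.1 w.1.1.2 w.1.2 =
  bern_exp pair_weight K (fun G => bern_exp (fun=> s) G (fun G1 =>
    bern_exp (fun=> s) G (fun G2 => F G G1 G2))).
Proof.
pose g (G G1 G2 : graph n) (pi : 'S_n) :=
  bern_pmf pair_weight K G * bern_pmf (fun=> s) G G1 * bern_pmf (fun=> s) G G2 *
  F G G1 G2 / n`!%:R.
rewrite (eq_bigr (fun w : outcome n => g w.1.1.1 w.1.1.2 w.1.2 w.2)); last first.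
  by case=> [[[G G1] G2] pi] _; rewrite corr_pmfE /g /= mulrAC.
rewrite -(pair_bigA _ (fun (t : graph n * graph n * graph n) pi => g t.1.1 t.1.2 t.2 pi)) /=.
rewrite -(pair_bigA _ (fun (t : graph n * graph n) G2 => \sum_pi g t.1 t.2 G2 pi)) /=.
rewrite -(pair_bigA _ (fun G G1 => \sum_G2 \sum_pi g G G1 G2 pi)) /=.
have n_fact : n`!%:R != 0 :> R by rewrite pnatr_eq0 -lt0n fact_gt0.
apply: eq_bigr => G _; rewrite [in RHS]/bern_exp mulr_sumr.
apply: eq_bigr => G1 _; rewrite !mulr_sumr.
apply: eq_bigr => G2 _; rewrite /g sumr_const card_Sn -[LHS]mulr_natr.
by rewrite -!mulrA mulVf // mulr1.
Qed.

Lemma bern_exp_common (F : graph n -> R) :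
  bern_exp pair_weight K (fun G => bern_exp (fun=> s) G (fun G1 =>
    bern_exp (fun=> s) G (fun G2 => F (G1 :&: G2)))) =
  bern_exp (fun a => pair_weight a * s ^+ 2) K F.
Proof.
rewrite expr2 -bern_exp_thin; apply: bern_exp_supp => G _.
rewrite -bern_exp_thin; apply: bern_exp_supp => G1 G1G.
by rewrite bern_exp_restrict (setIidPl G1G).
Qed.

Lemma corr_pmf_ge0 w : 0 <= corr_pmf x r p s w.
Proof.
case: w => [[[G G1] G2] pi]; rewrite corr_pmfE.
by rewrite !mulr_ge0 ?invr_ge0 ?bern_pmf_ge0 //; exact: pair_weight01.
Qed.

Lemma corr_prob_le1 E : corr_prob x r p s E <= 1.
Proof.
have <- : \sum_(w : outcome n) corr_pmf x r p s w * 1 = 1.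
  rewrite (corr_exp (fun _ _ _ => 1)) (@bern_exp_supp _ _ _ _ _ (fun=> 1)) ?bern_exp_const //.
  by move=> G _; rewrite !bern_exp_const.
rewrite /corr_prob big_mkcond; apply: ler_sum => w _; rewrite mulr1.
by case: ifP => // _; exact: corr_pmf_ge0.
Qed.

(** Neither bad event involves the permutation, which therefore averages out:
    the first one is about the parent graph, the second one about the edges
    common to [G_1] and [G_2']. *)
Lemma corr_prob_lower (E : graph n -> graph n -> 'S_n -> bool)
    (bad1 bad2 : graph n -> bool) :
  (forall G G1 G2 pi, G \subset K -> G1 \subset G -> G2 \subset G ->
     ~~ bad1 G -> ~~ bad2 (G1 :&: G2) -> E G1 (relabel pi G2) pi) ->
  1 - (bern_exp pair_weight K (fun G => (bad1 G)%:R) +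
       bern_exp (fun a => pair_weight a * s ^+ 2) K (fun H => (bad2 H)%:R))
  <= corr_prob x r p s E.
Proof.
move=> goodE.
pose F (G G1 G2 : graph n) : R := 1 + (-1 * (bad1 G)%:R + -1 * (bad2 (G1 :&: G2))%:R).
have -> : 1 - (bern_exp pair_weight K (fun G => (bad1 G)%:R) +
       bern_exp (fun a => pair_weight a * s ^+ 2) K (fun H => (bad2 H)%:R)) =
   \sum_(w : outcome n) corr_pmf x r p s w * F w.1.1.1 w.1.1.2 w.1.2.
  rewrite (corr_exp F) -bern_exp_common.
  pose J (G : graph n) : R := bern_exp (fun=> s) G (fun G1 =>
    bern_exp (fun=> s) G (fun G2 => (bad2 (G1 :&: G2))%:R)).
  transitivity (bern_exp pair_weight K (fun G => 1 + (-1 * (bad1 G)%:R + -1 * J G))).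
    by rewrite !bern_expD !bern_expZ bern_exp_const; ring.
  apply: bern_exp_supp => G _.
  transitivity (bern_exp (fun=> s) G (fun G1 => 1 + (-1 * (bad1 G)%:R + -1 *
     bern_exp (fun=> s) G (fun G2 => (bad2 (G1 :&: G2))%:R)))).
    by rewrite !bern_expD !bern_expZ !bern_exp_const.
  by apply: bern_exp_supp => G1 _; rewrite /F !bern_expD !bern_expZ !bern_exp_const.
rewrite /corr_prob [leRHS]big_mkcond; apply: ler_sum => -[[[G G1] G2] pi] _ /=.
have pmf0 := corr_pmf_ge0 (G, G1, G2, pi).
have [le_F|] : F G G1 G2 <= 0 \/ ~~ bad1 G /\ ~~ bad2 (G1 :&: G2).
- rewrite /F; case: (bad1 G); first by left; case: (bad2 _) => /=; lra.
  by case: (bad2 _) => /=; [left; lra | right].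
- apply: (@le_trans _ _ 0); last by case: ifP.
  by rewrite mulr_ge0_le0.
move=> [ok1 ok2]; rewrite /F (negPf ok1) (negPf ok2) !mulr0 !addr0 mulr1.
case: ifP => // notE; suff pmf_eq0 : corr_pmf x r p s (G, G1, G2, pi) = 0 by move: pmf_eq0 => /= ->.
rewrite corr_pmfE; apply/eqP; apply: contraFT notE => nz; apply: goodE ok1 ok2.
- by apply: contraNT nz => sub; rewrite /bern_pmf (negPf sub) !mul0r.
- by apply: contraNT nz => sub; rewrite /bern_pmf (negPf sub) mulr0 !mul0r.
- by apply: contraNT nz => sub; rewrite /bern_pmf (negPf sub) mulr0 mul0r.
Qed.

End Reduction.

(** * The estimator on [n] vertices *)

Lemma min_over_le (R : realType) (n : nat) (f : 'I_n -> R) i : min_over f <= f i.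
Proof. by case: n f i => [|n] f i; [case: i | exact: bigmin_le]. Qed.

Lemma min_over_attained (R : realType) (n : nat) (f : 'I_n -> R) : (0 < n)%N ->
  exists i, min_over f = f i.
Proof.
case: n f => // n f _; rewrite /min_over.
elim/big_ind: _ => [|a b [i ->] [j ->]|i _]; [by exists ord0| |by exists i].
by rewrite minEle; case: ifP => _; [exists i | exists j].
Qed.

(** On a set of large minimum degree in the common graph, the true permutation
    is itself a [13]-core matching. *)
Lemma core_matching (n : nat) (G1 G2 : graph n) (pi : 'S_n) (S : {set 'I_n}) :
  (forall i, i \in S -> (13 <= #|[set j in S | adj (G1 :&: G2) i j]|)%N) ->
  is_kcore_matching 13 G1 (relabel pi G2) (S, [ffun i => pi i]).
Proof.
move=> degS; split=> [i j _ _ /=|i iS /=]; first by rewrite !ffunE => /perm_inj.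
apply: leq_trans (degS i iS) _; apply/subset_leq_card/subsetP => j.
rewrite !in_set /adj in_setI => /and3P[jS ij1 ij2]; rewrite in_set ij1 /=.
apply/andP; split; first by rewrite subUset !sub1set iS jS.
rewrite (_ : _ @: _ = pi @: [set i; j]); first exact: imset_f.
by rewrite !imsetU1 !imset_set1 !ffunE.
Qed.

Lemma relabel_simple (n : nat) (pi : 'S_n) (G : graph n) :
  simple_graph G -> simple_graph (relabel pi G).
Proof.
move=> /subsetP GK; apply/subsetP => _ /imsetP[e eG ->].
have := GK e eG; rewrite !in_set card_imset //; exact: perm_inj.
Qed.

(** The finite form of the theorem, with [h] the fourth root of [n]. The ball
    around a vertex counts the vertex itself, which contributes [p * s ^ 2]; the
    slack [eps] absorbs it. *)
Lemma corr_prob_bound (R : realType) (n d : nat) (x : 'I_n -> 'rV[R]_d)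
    (r p s eps h : R) (est : graph n -> graph n -> pre_matching n) :
  (0 < n)%N -> 0 <= p <= 1 -> 0 <= s <= 1 -> is_kcore_estimator 13 est ->
  100 <= h -> h ^+ 4 = n%:R -> (n%:R * p) ^+ 4 <= h -> p <= eps ->
  Num.max (s * Num.sqrt (n%:R * p)) 154 + eps <=
    p * s ^+ 2 * min_over (fun i : 'I_n => (ball_count x r i)%:R) ->
  1 - 389 / h <= corr_prob x r p s (fun (G1 G2 : graph n) (pi : 'S_n) =>
    let M := (est G1 G2).1 in
    let mu := (est G1 G2).2 in
    ((1 - 3 * expR (- min_over (fun i : 'I_n =>
         \sum_(j < n) edge_prob x r p i j * s ^+ 2 / 7))) * n%:R -
       (3 * (n%:R / h) + 1) <= #|M|%:R)
    && (restr_graph mu M == restr_graph pi M)).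
Proof.
move=> n0 p01 s01 est_core h100 h4 om_h p_eps.
set u := Num.max _ _; set Delta := min_over (fun i : 'I_n => \sum_(j < n) _).
move=> hdeg.
have /andP[p0 p1] := p01; have /andP[s0 s1] := s01.
have nR : 0 < n%:R :> R by rewrite ltr0n.
have h0 : 0 < h by apply: lt_le_trans h100.
have s2 : 0 <= s ^+ 2 <= 1 by rewrite exprn_ge0 // exprn_ile1.
have /andP[s20 s21] := s2.
have u154 : 154 <= u by rewrite /u le_max lexx orbT.
pose om : R := n%:R * p; pose lam : R := om * s ^+ 2.
have om0 : 0 <= om by rewrite mulr_ge0 // ltW.
pose q a := pair_weight x r p a * s ^+ 2.
have q01 a : 0 <= q a <= 1.
  have /andP[w0 w1] := pair_weight01 x r p01 a.
  by rewrite mulr_ge0 //= mulr_ile1.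
have q_lam a : q a <= lam / n%:R.
  have /andP[_ wp] := pair_weight_bounds x r p01 a.
  rewrite (_ : lam / n%:R = p * s ^+ 2); first by rewrite ler_wpM2r.
  by rewrite /lam /om; field; rewrite gt_eqF.
have deg_q i : \sum_(j < n) edge_prob x r p i j * s ^+ 2 / 7 * 7 =
    \sum_(j | j != i) q [set i; j].
  rewrite (bigD1 i) //= {1}/edge_prob eqxx !mul0r add0r; apply: eq_bigr => j _.
  by rewrite divfK // /q pair_weightE.
have deg_Delta i : 7 * Delta <= \sum_(j | j != i) q [set i; j].
  rewrite -deg_q -mulr_suml mulrC ler_wpM2r //; exact: min_over_le.
have ball_le i : p * s ^+ 2 * (ball_count x r i)%:R <=
    \sum_(j | j != i) q [set i; j] + p.
  rewrite /ball_count -sum1_card natr_sum mulr_sumr (bigID (pred1 i)) /= addrC.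
  apply: lerD.
    rewrite big_mkcond [leRHS]big_mkcond; apply: ler_sum => j _.
    rewrite in_set; case: (eqVneq j i) => [->|ji]; rewrite ?andbF ?andbT //.
    rewrite /q pair_weightE /edge_prob [i == j]eq_sym ji /=.
    by case: ifP => _; rewrite ?mulr1 // mul0r.
  apply: (@le_trans _ _ (\sum_(j < n | j == i) p)); last by rewrite big_pred1_eq.
  rewrite big_mkcond [leRHS]big_mkcond; apply: ler_sum => j _.
  by case: eqP => _; rewrite ?andbF // andbT; case: ifP => _; rewrite ?mulr1 ?ler_piMr.
have u_Delta : u <= 7 * Delta.
  have [i Di] := min_over_attained (fun i : 'I_n =>
    \sum_(j < n) edge_prob x r p i j * s ^+ 2 / 7) n0.
  have Dq : 7 * Delta = \sum_(j | j != i) q [set i; j].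
    by rewrite -deg_q -mulr_suml mulrC -Di.
  have minb : min_over (fun i : 'I_n => (ball_count x r i)%:R) <= (ball_count x r i)%:R :> R.
    exact: min_over_le.
  have := ler_wpM2l (mulr_ge0 p0 s20) minb.
  by have := ball_le i; rewrite -Dq; lra.
have lam154 : 154 <= lam.
  have [i mi] := min_over_attained (fun i : 'I_n => (ball_count x r i)%:R : R) n0.
  have eps0 : 0 <= eps by apply: le_trans p_eps.
  apply: (@le_trans _ _ (p * s ^+ 2 * (ball_count x r i)%:R)).
    by rewrite -mi; apply: le_trans hdeg; lra.
  rewrite (_ : lam = p * s ^+ 2 * n%:R); last by rewrite /lam /om; ring.
  rewrite ler_wpM2l ?mulr_ge0 // ler_nat.
  by rewrite -[X in (_ <= X)%N](card_ord n) max_card.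
have lam1 : 1 <= lam by lra.
have lam_om : lam <= om by rewrite /lam ler_piMr.
have om1 : 1 <= om by apply: le_trans lam_om.
have lam_h : lam ^+ 4 <= h.
  by apply: le_trans om_h; apply: lerXn2r; rewrite ?nnegrE //; lra.
have lam_u : lam <= u ^+ 2.
  rewrite /lam mulrC -(sqr_sqrtr om0) -exprMn; apply: lerXn2r.
  - by rewrite nnegrE mulr_ge0 ?sqrtr_ge0.
  - by rewrite nnegrE; lra.
  - by rewrite /u le_max lexx.
have om8 : om ^+ 8 <= h ^+ 2.
  rewrite (_ : 8 = 4 * 2)%N // exprM; apply: lerXn2r; rewrite ?nnegrE ?exprn_ge0 //.
  exact: ltW.
have om_small : 128 * om ^+ 8 <= n%:R.
  rewrite -h4 (_ : h ^+ 4 = h ^+ 2 * h ^+ 2); last by rewrite -exprD.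
  apply: ler_pM; rewrite ?exprn_ge0 //.
  by apply: (@le_trans _ _ (100 ^+ 2)); [lra | apply: lerXn2r; rewrite ?nnegrE // ltW].
have [m m_le core_bad] :=
  core_prob q01 n0 q_lam h100 h4 lam1 lam_h u154 lam_u u_Delta deg_Delta.
have mis_bad := misleading_prob (pair_weight01 x r p01)
  (fun a => proj2 (andP (pair_weight_bounds x r p01 a))) n0 (erefl om) om1 om_small.
apply: le_trans (@corr_prob_lower R n d x r p s p01 s01 _ (@misleading n)
  (fun H => ~~ has_core m H) _).
  rewrite lerD2l lerN2; apply: (@le_trans _ _ (384 / h + 5 / h)); last first.
    by rewrite -mulrDl; apply: ler_wpM2r; [rewrite invr_ge0 ltW | lra].
  apply: lerD; last exact: core_bad.
  apply: le_trans mis_bad _; rewrite ler_pdivrMr // -h4.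
  rewrite (_ : 384 / h * h ^+ 4 = 384 * h ^+ 3); last by field; rewrite gt_eqF.
  apply: ler_wpM2l; [exact: ler0n | apply: le_trans om8 _].
  by rewrite ler_weXn2l //; apply: le_trans h100; rewrite ler1n.
move=> G G1 G2 pi GK G1G G2G notmis /negPn /existsP[S /andP[S_size /forallP degS]].
have sG1 : simple_graph G1 by apply: subset_trans GK.
have sG2 : simple_graph (relabel pi G2) by apply/relabel_simple/(subset_trans G2G).
have [kcore kmax] := est_core _ _ sG1 sG2.
apply/andP; split; last first.
  by apply/eqP; apply: (matching_correct G1G G2G notmis kcore).
have S_core : is_kcore_matching 13 G1 (relabel pi G2) (S, [ffun i => pi i]).
  by apply: core_matching => i iS; have := degS i; rewrite iS.
have n_le : n%:R <= #|(est G1 (relabel pi G2)).1|%:R + m%:R :> R.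
  by rewrite -natrD ler_nat; apply: leq_trans S_size _; rewrite leq_add2r; exact: (kmax _ S_core).
by move: m_le n_le; lra.
Qed.

(** * The limit *)

Local Open Scope classical_set_scope.
Local Open Scope ring_scope.

Theorem corollary6 (R : realType) (d : nat -> nat)
    (x : forall n : nat, 'I_n -> 'rV[R]_(d n)) (r p s : nat -> R) (eps : R)
    (kest : forall n : nat, graph n -> graph n -> pre_matching n)
    (hd : forall n, (0 < d n)%N)
    (hx : forall n (i : 'I_n), l2norm (x n i) = 1)
    (hr : forall n, 0 <= r n <= 2)
    (hp : forall n, 0 <= p n <= 1)
    (hs : forall n, 0 <= s n <= 1)
    (hpn : exists eta : nat -> R,
       (fun n => eta n) @ \oo --> (0 : R) /\
       \forall n \near \oo, p n = n%:R `^ (- 1 + eta n))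
    (heps : 0 < eps)
    (hdeg : \forall n \near \oo,
       Num.max (s n * Num.sqrt (n%:R * p n)) 154 + eps
       <= p n * s n ^+ 2
          * min_over (fun i : 'I_n => (ball_count (x n) (r n) i)%:R))
    (hkest : forall n, is_kcore_estimator 13 (kest n)) :
  exists a : nat -> R,
    (fun n => a n / n%:R) @ \oo --> (0 : R) /\
    (fun n =>
       corr_prob (x n) (r n) (p n) (s n)
         (fun (G1 G2 : graph n) (pi : 'S_n) =>
            let M := (kest n G1 G2).1 in
            let mu := (kest n G1 G2).2 in
            ((1 - 3 * expR (- min_over (fun i : 'I_n =>
                  \sum_(j < n) edge_prob (x n) (r n) (p n) i j * s n ^+ 2 / 7)))
               * n%:R - a n <= #|M|%:R)
            && (restr_graph mu M == restr_graph pi M)))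
      @ \oo --> (1 : R).
Proof.
have [eta [eta0 p_eta]] := hpn.
pose h (n : nat) : R := n%:R `^ 4^-1.
have h4 n : h n ^+ 4 = n%:R.
  by rewrite /h -powR_mulrn ?powR_ge0 // -powRrM mulVf ?powRr1.
have h_ge0 n : 0 <= h n by exact: powR_ge0.
have h_large (A : R) : 0 <= A -> \forall n \near \oo, A <= h n.
  move=> A0; have := nbhs_infty_ger (A ^+ 4); apply: filterS => n le_n.
  by rewrite -(@ler_pXn2r _ 4) ?nnegrE ?h4.
have hV : (fun n => (h n)^-1) @ \oo --> (0 : R).
  apply/cvgrPdist_le => e e0; have := h_large (e^-1) (ltW _); rewrite invr_gt0 => /(_ e0).
  apply: filterS => n le_h; rewrite sub0r normrN ger0_norm ?invr_ge0 //.
  rewrite -[leRHS]invrK lef_pV2 ?posrE ?invr_gt0 //.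
  by apply: lt_le_trans le_h; rewrite invr_gt0.
have lin_cvg (c k : R) : (fun n => c + k * (h n)^-1) @ \oo --> c.
  rewrite -[X in _ --> X]addr0 -[X in _ --> _ + X](mulr0 k).
  by apply: cvgD; [exact: cvg_cst | apply: cvgMr].
exists (fun n => 3 * (n%:R / h n) + 1); split.
  apply: (@squeeze_cvgr _ _ _ _ (fun=> 0) (fun n => 0 + 4 * (h n)^-1)); last 2 first.
  - exact: cvg_cst.
  - exact: lin_cvg.
  have := h_large 1 ler01; apply: filterS => n h1.
  have h0 : 0 < h n by apply: lt_le_trans h1.
  have nR : 0 < n%:R :> R by rewrite -h4 exprn_gt0.
  apply/andP; split.
    by rewrite divr_ge0 // addr_ge0 // !mulr_ge0 // invr_ge0.
  rewrite add0r ler_pdivrMr // -mulrA [_ * n%:R]mulrC.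
  suff : 1 <= n%:R / h n by lra.
  rewrite ler_pdivlMr // mul1r -h4 -[leLHS]expr1.
  exact: ler_weXn2l.
apply: (@squeeze_cvgr _ _ _ _ (fun n => 1 + - 389 * (h n)^-1) (fun=> 1)); last 2 first.
- exact: lin_cvg.
- exact: cvg_cst.
have eta_small : \forall n \near \oo, eta n <= 16^-1.
  have /cvgrPdist_le/(_ 16^-1) := eta0; rewrite invr_gt0 => /(_ (ltr0n _ 16)).
  by apply: filterS => n; rewrite sub0r normrN => /(le_trans (ler_norm _)).
have eps_large : \forall n \near \oo, eps^-1 <= h n.
  by apply: h_large; rewrite invr_ge0 ltW.
have h100 := h_large 100 (ler0n _ _).
near=> n; apply/andP; split; last exact: corr_prob_le1.
have h_n : 100 <= h n by near: n.
have h0 : 0 < h n by apply: lt_le_trans h_n.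
have nR : 0 < n%:R :> R by rewrite -h4 exprn_gt0.
have n0 : (0 < n)%N by rewrite -(ltr0n R).
have pE : n%:R * p n = n%:R `^ eta n.
  have -> : p n = n%:R `^ (- 1 + eta n) by near: n.
  have nz : n%:R != 0 :> R by rewrite gt_eqF.
  rewrite -[X in X * _]powRr1 ?ler0n // -powRD ?nz ?implybT //.
  by rewrite addrA subrr add0r.
(* [n * p = n ^ eta] with [eta <= 1 / 16]. *)
have om_h : (n%:R * p n) ^+ 4 <= h n.
  rewrite pE -powR_mulrn ?powR_ge0 // -powRrM; apply: ler_powR; first by rewrite ler1n.
  have : eta n <= 16^-1 by near: n.
  lra.
have p_eps : p n <= eps.
  have /andP[p0 _] := hp n.
  have om0 : 0 <= n%:R * p n by rewrite mulr_ge0 // ltW.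
  have om_le : n%:R * p n <= h n.
    have [le1|gt1] := lerP (n%:R * p n) 1; first by apply: le_trans le1 _; lra.
    by apply: le_trans om_h; rewrite -[leLHS]expr1 ler_weXn2l // ltW.
  have eps_h : eps^-1 <= h n by near: n.
  have : 1 <= eps * h n by rewrite -ler_pdivrMl // mulr1.
  move=> eps1; rewrite -(ler_pM2l nR); apply: le_trans om_le _.
  rewrite -h4 (_ : h n ^+ 4 * eps = (eps * h n) * h n ^+ 3); last by ring.
  apply: (@le_trans _ _ (1 * h n ^+ 3)); last by rewrite ler_wpM2r ?exprn_ge0.
  by rewrite mul1r -[leLHS]expr1 ler_weXn2l //; lra.
rewrite mulNr; apply: (corr_prob_bound n0 (hp n) (hs n) (hkest n) h_n (h4 n) om_h p_eps).
by near: n.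
Unshelve. all: end_near.
Qed.
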